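(* Let $\beta\in\mathbb{C}^N$ and let $(\mathfrak{g},L,F)$ be one of $(\mathfrak{gl}_N,\mathcal{W}_N,F^\beta_{\mathcal{W}})$ with $N\geq2$, $(\mathfrak{sl}_N,\mathcal{S}_N,F^\beta_{\mathcal{S}})$ with $N\geq2$, or $(\mathfrak{sp}_N,\mathcal{H}_N,L^\beta_{\mathcal{H}})$ with $N=2n$, $n\geq1$. If $V$ is a non-trivial irreducible $\mathfrak{g}$-module, then the $L$-module $F(V)=V\otimes A_N$ is indecomposable. Moreover, every non-zero proper $L$-submodule of $F(V)$ is also indecomposable up to trivial summands, i.e. it is the direct sum of an indecomposable submodule and a (possibly zero) trivial submodule.
   Context: All over $\mathbb{C}$. $\mathbb{C}^N$ is the space of column vectors, $(u|v)=u^Tv$, $A_N=\mathbb{C}[t_1^{\pm1},\ldots,t_N^{\pm1}]$, $t^k=t_1^{k_1}\cdots t_N^{k_N}$ for $k\in\mathbb{Z}^N$, $d_i=t_i\partial/\partial t_i$, and $D(u,r)=\sum_i u_it^rd_i$ for $u\in\mathbb{C}^N,r\in\mathbb{Z}^N$. The Lie algebras (under commutator of derivations of $A_N$) are $\mathcal{W}_N=\mathrm{Der}(A_N)=\mathrm{span}\{D(u,r)\}$; $\mathcal{S}_N=\mathrm{span}\{D(u,r) : (u|r)=0\}$; and, for $N=2n$, $\mathcal{H}_N=\mathrm{span}\{h_r,d_i : 0\neq r\in\mathbb{Z}^N,1\leq i\leq N\}$ with $h_r=\sum_{i=1}^n(r_{n+i}t^rd_i-r_it^rd_{n+i})$. For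 $w\in\mathbb{C}^{2n}$, $\overline{w}=(w_{n+1},\ldots,w_{2n},-w_1,\ldots,-w_n)$. Shen–Larsson modules. For a $\mathfrak{gl}_N$-module $V$, $F^\beta_{\mathcal{W}}(V)=V\otimes A_N$ with $D(u,r)(v\otimes t^k)=(u|k+\beta)v\otimes t^{k+r}+(ru^T)v\otimes t^{k+r}$. For an $\mathfrak{sl}_N$-module $V$, $F^\beta_{\mathcal{S}}(V)=V\otimes A_N$ with the same formula for $D(u,r)$, $r\neq0$, $(u|r)=0$, and $d_i(v\otimes t^k)=(k_i+\alpha_i)v\otimes t^k$, where $\alpha\in\mathbb{C}^N$ is fixed and arbitrary. For an $\mathfrak{sp}_N$-module $V$ ($\mathfrak{sp}_N=\{A : A^TJ+JA=0\}$, $J=\begin{pmatrix}0&\mathrm{Id}_n\\-\mathrm{Id}_n&0\end{pmatrix}$), $L^\beta_{\mathcal{H}}(V)=V\otimes A_N$ with $h_r(v\otimes t^k)=(\overline r|k+\beta)v\otimes t^{k+r}+(r\overline r^T)v\otimes t^{k+r}$ and $d_i(v\otimes t^k)=(k_i+\alpha_i)v\otimes t^k$. A non-trivial irreducible $\mathfrak{g}$-module is an irreducible module not isomorphic to the one-dimensional module with zero action; it need not be finite-dimensional or a weight module. A ''trivial'' submodule is one on which all elements of $L$ of non-zero $\mathbb{Z}^N$-degree (i.e. all $D(u,r)$, resp. $h_r$, in $L$ with $r\neq0$) act by zero. *)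

(* Defs.v *)
From HB Require Import structures.
From mathcomp Require Import all_boot all_order all_algebra.
From mathcomp Require Import finmap all_classical reals.
From mathcomp Require Import ssrAC ring.
From mathcomp Require Export complex.

Set Implicit Arguments.
Unset Strict Implicit.
Unset Printing Implicit Defensive.

Import GRing.Theory.

Local Open Scope classical_set_scope.
Local Open Scope ring_scope.

Section LieModules.
Variables (C : fieldType) (E : lmodType C) (br : E -> E -> E) (g : set E).

(* The ambient space E (matrices or operators) carries the bracket br, and g is
   a Lie subalgebra of it. An action of g is a map E -> V -> V all of whose
   values outside g are irrelevant. *)
Definition is_lie_module (V : lmodType C) (rho : E -> V -> V) : Prop :=
  [/\ forall (a : C) (X Y : E) (v : V), g X -> g Y ->
        rho (a *: X + Y) v = a *: rho X v + rho Y v,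
      forall X : E, g X -> linear (rho X) &
      forall (X Y : E) (v : V), g X -> g Y ->
        rho (br X Y) v = rho X (rho Y v) - rho Y (rho X v)].

Definition is_submodule (V : lmodType C) (rho : E -> V -> V) (M : set V) : Prop :=
  GRing.submod_closed (mem M) /\ (forall X v, g X -> M v -> M (rho X v)).

Definition irreducible_module (V : lmodType C) (rho : E -> V -> V) : Prop :=
  [set: V] <> [set 0] /\
  (forall M : set V, is_submodule rho M -> M = [set 0] \/ M = setT).

Definition isomorphic_modules (V W : lmodType C)
    (rho : E -> V -> V) (sigma : E -> W -> W) : Prop :=
  exists f : {linear V -> W},
    bijective f /\ (forall X v, g X -> f (rho X v) = sigma X (f v)).

Definition nontrivial_irreducible (V : lmodType C) (rho : E -> V -> V) : Prop :=
  [/\ is_lie_module rho, irreducible_module rho &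
      ~ isomorphic_modules rho (fun _ (_ : C^o) => 0)].

Definition direct_sum (V : lmodType C) (M P Q : set V) : Prop :=
  M = [set x + y | x in P & y in Q] /\ P `&` Q = [set 0].

Definition indecomposable (V : lmodType C) (rho : E -> V -> V) (M : set V) : Prop :=
  [/\ is_submodule rho M, M <> [set 0] &
      forall P Q : set V, is_submodule rho P -> is_submodule rho Q ->
        direct_sum M P Q -> P = [set 0] \/ Q = [set 0]].

End LieModules.

Definition subspace_span (C : fieldType) (E : lmodType C) (S : set E) : set E :=
  [set X | forall P : set E, GRing.submod_closed (mem P) -> S `<=` P -> P X].

(* V (x) A_N, as the space of V-valued Laurent polynomials in t_1, ..., t_N:
   functions from exponents in Z^N to V with finite support. *)
Section Laurent.
Variables (C : fieldType) (N : nat) (V : lmodType C).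

Definition finite_supp : {pred 'cV[int]_N -> V} :=
  fun f => `[< finite_set [set k | f k != 0] >].

Fact finite_supp_submod : GRing.submod_closed finite_supp.
Proof.
split=> [|a f g /asboolP ff /asboolP fg]; apply/asboolP.
  by apply: (@sub_finite_set _ _ set0) => // k /=; rewrite eqxx.
apply: (@sub_finite_set _ _ ([set k | f k != 0] `|` [set k | g k != 0])).
  move=> k /= h; have [fk0|fk] := eqVneq (f k) 0; last by left.
  right; apply: contra_neq h => gk0.
  by rewrite -[LHS]/(a *: f k + g k) fk0 gk0 scaler0 addr0.
by rewrite finite_setU.
Qed.

HB.instance Definition _ :=
  GRing.isSubmodClosed.Build C ('cV[int]_N -> V) finite_supp finite_supp_submod.

Record laurent := Laurent {
  laurent_coef :> 'cV[int]_N -> V;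
  _ : laurent_coef \in finite_supp }.

HB.instance Definition _ := [isSub for laurent_coef].
HB.instance Definition _ := [Choice of laurent by <:].
HB.instance Definition _ := [SubChoice_isSubLmodule of laurent by <:].

Fact mon_subproof (v : V) (k : 'cV[int]_N) :
  (fun m => if m == k then v else 0) \in finite_supp.
Proof.
apply/asboolP; apply: (@sub_finite_set _ _ [set k]) => // m /=.
by case: (m =P k) => // _; rewrite eqxx.
Qed.

Definition mon (v : V) (k : 'cV[int]_N) : laurent := Laurent (mon_subproof v k).

End Laurent.

Section Operators.
Variables (C : fieldType) (N : nat).

Definition pairing (u v : 'cV[C]_N) : C := (u^T *m v) 0 0.

Definition expC (k : 'cV[int]_N) : 'cV[C]_N := map_mx intr k.

Definition laurent_alg := laurent N (C^o : lmodType C).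
HB.instance Definition _ := GRing.Lmodule.on laurent_alg.

Implicit Types (r k : 'cV[int]_N) (f : laurent_alg).

Fact tmul_subproof r f : (fun m => f (m - r)) \in @finite_supp C N C^o.
Proof.
case: f => f /= /asboolP ff; apply/asboolP.
apply: (@sub_finite_set _ _ ((fun k => k + r) @` [set k | f k != 0])).
  by move=> m /= h; exists (m - r) => //; rewrite subrK.
exact: finite_image.
Qed.

(* multiplication by t^r *)
Definition tmul r f : laurent_alg := Laurent (tmul_subproof r f).

Fact tdiff_subproof (i : 'I_N) f :
  (fun m : 'cV[int]_N => (m i 0)%:~R * f m) \in @finite_supp C N C^o.
Proof.
case: f => f /= /asboolP ff; apply/asboolP; apply: sub_finite_set ff => m /=.
by apply: contra_neq => ->; rewrite mulr0.
Qed.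

(* d_i = t_i d/dt_i *)
Definition tdiff (i : 'I_N) f : laurent_alg := Laurent (tdiff_subproof i f).

Definition derD (u : 'cV[C]_N) r : laurent_alg -> laurent_alg :=
  fun f => \sum_(i < N) u i 0 *: tmul r (tdiff i f).

Definition op_br (X Y : laurent_alg -> laurent_alg) : laurent_alg -> laurent_alg :=
  (X \o Y) - (Y \o X).

Definition lieW : set (laurent_alg -> laurent_alg) :=
  subspace_span [set derD x.1 x.2 | x in [set: 'cV[C]_N * 'cV[int]_N]].

Definition lieS : set (laurent_alg -> laurent_alg) :=
  subspace_span [set derD x.1 x.2 | x in
    [set x : 'cV[C]_N * 'cV[int]_N | pairing x.1 (expC x.2) = 0]].

Definition mx_br (A B : 'M[C]_N) : 'M[C]_N := A *m B - B *m A.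

Definition gl : set 'M[C]_N := setT.
Definition sl : set 'M[C]_N := [set A | \tr A = 0].

End Operators.
Arguments expC {C N}.
Arguments gl {C N}.
Arguments sl {C N}.
Arguments lieW {C N}.
Arguments lieS {C N}.

Section Symplectic.
Variables (C : fieldType) (n : nat).

Definition Jmx : 'M[C]_(n + n) := block_mx 0 1%:M (- 1%:M) 0.

Definition sp : set 'M[C]_(n + n) := [set A | A^T *m Jmx + Jmx *m A = 0].

Definition overline (w : 'cV[C]_(n + n)) : 'cV[C]_(n + n) :=
  col_mx (dsubmx w) (- usubmx w).

Definition derh (r : 'cV[int]_(n + n)) :
    laurent_alg C (n + n) -> laurent_alg C (n + n) :=
  fun f => \sum_(i < n)
    ((expC r (rshift n i) 0 : C) *: tmul r (tdiff (lshift n i) f)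
     - (expC r (lshift n i) 0 : C) *: tmul r (tdiff (rshift n i) f)).

Definition lieH : set (laurent_alg C (n + n) -> laurent_alg C (n + n)) :=
  subspace_span ([set derh r | r in [set r | r != 0]]
                 `|` range (@tdiff C (n + n))).

End Symplectic.
Arguments sp {C n}.
Arguments lieH {C n}.

(* The relations "Phi is the action of L on V (x) A_N" defining the
   Shen-Larsson modules. As L is spanned by the elements for which Phi is
   prescribed, there is at most one such Phi on L; existence is
   Existence.shen_larssonW_exists, and likewise for S and H. In the S and H
   cases the d_i act through alpha, which is unrelated to beta. *)
Section ShenLarsson.
Variables (C : fieldType) (N : nat) (V : lmodType C).
Variable rho : 'M[C]_N -> V -> V.
Implicit Type Phi :
  (laurent_alg C N -> laurent_alg C N) -> laurent N V -> laurent N V.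

Definition is_shen_larssonW (beta : 'cV[C]_N) Phi : Prop :=
  is_lie_module (@op_br C N) lieW Phi /\
  (forall u r v k,
     Phi (derD u r) (mon v k) =
     mon (pairing u (expC k + beta) *: v) (k + r)
     + mon (rho (expC r *m u^T) v) (k + r)).

Definition is_shen_larssonS (alpha beta : 'cV[C]_N) Phi : Prop :=
  [/\ is_lie_module (@op_br C N) lieS Phi,
      forall u r v k, r != 0 -> pairing u (expC r) = 0 ->
        Phi (derD u r) (mon v k) =
        mon (pairing u (expC k + beta) *: v) (k + r)
        + mon (rho (expC r *m u^T) v) (k + r) &
      forall i v k,
        Phi (@tdiff C N i) (mon v k) = mon (((k i 0)%:~R + alpha i 0) *: v) k].

End ShenLarsson.

Definition is_shen_larssonH (C : fieldType) (n : nat) (V : lmodType C)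
    (rho : 'M[C]_(n + n) -> V -> V) (alpha beta : 'cV[C]_(n + n))
    (Phi : (laurent_alg C (n + n) -> laurent_alg C (n + n)) ->
           laurent (n + n) V -> laurent (n + n) V) : Prop :=
  [/\ is_lie_module (@op_br C (n + n)) lieH Phi,
      forall r v k, r != 0 ->
        Phi (derh r) (mon v k) =
        mon (pairing (overline (expC r)) (expC k + beta) *: v) (k + r)
        + mon (rho (expC r *m (overline (expC r))^T) v) (k + r) &
      forall i v k,
        Phi (@tdiff C (n + n) i) (mon v k) =
        mon (((k i 0)%:~R + alpha i 0) *: v) k].

(* For L = lieW, lieS or lieH, the elements of L of Z^N-degree r are the
   D(u, r) in L. In lieH these are, for r <> 0, the multiples of derh r, by
   Existence.derhE. *)
Definition trivial_on (C : fieldType) (N : nat) (V : lmodType C)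
    (L : set (laurent_alg C N -> laurent_alg C N))
    (Phi : (laurent_alg C N -> laurent_alg C N) -> V -> V) (M : set V) : Prop :=
  forall u r v, r != 0 -> L (derD u r) -> M v -> Phi (derD u r) v = 0.

Definition indecomposable_up_to_trivial (C : fieldType) (N : nat)
    (V : lmodType C) (L : set (laurent_alg C N -> laurent_alg C N))
    (Phi : (laurent_alg C N -> laurent_alg C N) -> V -> V) (M : set V) : Prop :=
  exists I T : set V,
    [/\ indecomposable L Phi I, is_submodule L Phi T, trivial_on L Phi T
      & direct_sum M I T].

(* The Shen-Larsson actions exist. All three Lie algebras are spans of a family
   Gam of derivations D(u, r), and their actions are instances of slaction. *)
Module Existence.

Section Existence.
Variables (C : fieldType) (N : nat) (V : lmodType C).
Variables (g : set 'M[C]_N) (rho : 'M[C]_N -> V -> V).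
Variables (alpha beta : 'cV[C]_N).
Variable Gam : set ('cV[C]_N * 'cV[int]_N).
Hypothesis g_sub : GRing.submod_closed (mem g).
Hypothesis rhoP : is_lie_module (@mx_br C N) g rho.
Hypothesis Gam_g : forall u r, Gam (u, r) -> g (expC r *m u^T).
Hypothesis Gam_ab :
  alpha = beta \/ (forall u r, Gam (u, r) -> pairing u (expC r) = 0).

Local Notation A := (laurent_alg C N).
Local Notation F := (laurent N V).
Let L : set (A -> A) := subspace_span [set derD x.1 x.2 | x in Gam].
Let br2 (u : 'cV[C]_N) (r : 'cV[int]_N) w s : 'cV[C]_N :=
  pairing u (expC s) *: w - pairing w (expC r) *: u.
Hypothesis Gam_br : forall u r w s, Gam (u, r) -> Gam (w, s) ->
  L (derD (br2 u r w s) (r + s)).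

Lemma pairingE (u v : 'cV[C]_N) : pairing u v = \sum_i u i 0 * v i 0.
Proof. by rewrite /pairing mxE; apply: eq_bigr => i _; rewrite mxE. Qed.

Lemma pairingDl (a : C) (u w v : 'cV[C]_N) :
  pairing (a *: u + w) v = a * pairing u v + pairing w v.
Proof. by rewrite /pairing linearP mulmxDl -scalemxAl !mxE. Qed.

Lemma pairingDr (u v w : 'cV[C]_N) : pairing u (v + w) = pairing u v + pairing u w.
Proof. by rewrite /pairing mulmxDr mxE. Qed.

Lemma pairing_br u r w s v : pairing (br2 u r w s) v =
  pairing u (expC s) * pairing w v - pairing w (expC r) * pairing u v.
Proof.
rewrite /br2 addrC -scaleNr pairingDl -[_ *: w]addr0 pairingDl.
by rewrite [pairing 0 _]/pairing trmx0 mul0mx mxE addr0 addrC mulNr.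
Qed.

Lemma lmod_br_identity (p q a b : C) (X Y x y v : V) :
  (p * b - q * a) *: v + (X - Y - (q *: x - p *: y)) =
  (a + p) *: (b *: v + y) + (b *: x + X) - ((b + q) *: (a *: v + x) + (a *: y + Y)).
Proof.
rewrite !(scalerDl, scalerDr) !scalerA [b * a]mulrC scaleNr.
set v1 := (a * b) *: v; set v2 := (p * b) *: v; set v3 := (q * a) *: v.
set x1 := b *: x; set x2 := q *: x; set y1 := a *: y; set y2 := p *: y.
have -> : v1 + y1 + (v2 + y2) + (x1 + X) = (v2 + y2 + X) + (v1 + y1 + x1).
  by rewrite (AC (2*2*2) ((3*4*6)*(1*2*5))).
have -> : v1 + x1 + (v3 + x2) + (y1 + Y) = (v1 + y1 + x1) + (v3 + x2 + Y).
  by rewrite (AC (2*2*2) ((1*5*2)*(3*4*6))).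
rewrite addrKA !opprD !opprK.
by rewrite (AC (2*(2*2)) ((1*6*3)*(2*5*4))).
Qed.

Lemma expCD r s : expC (r + s) = expC r + expC s :> 'cV[C]_N.
Proof. by apply/matrixP => i j; rewrite !mxE rmorphD. Qed.

Lemma expC0 : expC 0 = 0 :> 'cV[C]_N.
Proof. by apply/matrixP => i j; rewrite !mxE. Qed.

Lemma laurentP (W : lmodType C) (f h : laurent N W) : f =1 h -> f = h.
Proof. by move=> fh; apply/val_inj/funext. Qed.

Lemma coefP (W : lmodType C) a (f h : laurent N W) m : (a *: f + h) m = a *: f m + h m.
Proof. by []. Qed.

Lemma coef_sum (W : lmodType C) (T : Type) (s : seq T) (G : T -> laurent N W) m :
  (\sum_(i <- s) G i) m = \sum_(i <- s) G i m.
Proof. by elim/big_rec2: _ => // i x y _ <-. Qed.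

Lemma monP (W : lmodType C) a (v w : W) (k : 'cV[int]_N) :
  mon (a *: v + w) k = a *: mon v k + mon w k.
Proof.
apply: laurentP => m; rewrite coefP /=; case: eqP => //.
by rewrite scaler0 addr0.
Qed.

Lemma mon0 (W : lmodType C) (k : 'cV[int]_N) : mon (0 : W) k = 0.
Proof. by apply: laurentP => m /=; case: eqP. Qed.

Lemma monD (W : lmodType C) (v w : W) (k : 'cV[int]_N) :
  mon (v + w) k = mon v k + mon w k.
Proof. by rewrite -[v]scale1r monP !scale1r. Qed.

Lemma monZ (W : lmodType C) a (v : W) (k : 'cV[int]_N) : mon (a *: v) k = a *: mon v k.
Proof. by rewrite -[a *: v]addr0 monP mon0 addr0. Qed.

Lemma monB (W : lmodType C) (v w : W) (k : 'cV[int]_N) :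
  mon (v - w) k = mon v k - mon w k.
Proof. by rewrite monD -scaleN1r monZ scaleN1r. Qed.

Definition lsupp (W : lmodType C) (f : laurent N W) : {fset 'cV[int]_N} :=
  fset_set [set k | f k != 0].

Lemma lsuppP (W : lmodType C) (f : laurent N W) k : k \notin lsupp f -> f k = 0.
Proof.
case: f => f Hf /=; have /asboolP ff := Hf.
by rewrite in_fset_set // notin_setE /= => /negP; rewrite negbK => /eqP.
Qed.

Lemma laurentE (W : lmodType C) (f : laurent N W) :
  f = \sum_(k <- lsupp f) mon (f k) k.
Proof.
apply: laurentP => m; rewrite coef_sum /=.
have [mf|mf] := boolP (m \in lsupp f).
  rewrite (big_rem m) //= eqxx big_seq big1 ?addr0 // => k.
  by rewrite mem_rem_uniq ?fset_uniq // inE => /andP[/negPf km _]; rewrite eq_sym km.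
rewrite (lsuppP mf) big_seq big1 // => k kf.
by case: eqP => // mk; rewrite mk kf in mf.
Qed.

Lemma pairing_delta (i : 'I_N) (v : 'cV[C]_N) : pairing (delta_mx i 0) v = v i 0.
Proof. by rewrite /pairing trmx_delta -rowE mxE. Qed.

Lemma tdiff_derD (i : 'I_N) : tdiff i = derD (delta_mx i 0 : 'cV[C]_N) 0.
Proof.
apply/funext => f; apply: laurentP => m; rewrite coef_sum (bigD1 i) //= big1.
  rewrite -[RHS]/(_ * (_ * _) + 0 : C) mxE !eqxx mul1r addr0 subr0.
  by [].
by move=> j ji; rewrite -[LHS]/(_ * (_ * _) : C) mxE (negPf ji) mul0r.
Qed.

Definition symb (X : A -> A) (r : 'cV[int]_N) : 'cV[C]_N :=
  \col_i (X (mon (1 : C^o) (delta_mx i 0)) : laurent _ _) (r + delta_mx i 0).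

Lemma symbP a X Y r : symb (a *: X + Y) r = a *: symb X r + symb Y r.
Proof. by apply/matrixP => i j; rewrite !mxE. Qed.

Definition symb_supp (X : A -> A) : {fset 'cV[int]_N} :=
  fset_set (\bigcup_(i in [set: 'I_N])
    [set r | (X (mon (1 : C^o) (delta_mx i 0)) : laurent _ _) (r + delta_mx i 0) != 0]).

Lemma symb_suppP X r : r \notin symb_supp X -> symb X r = 0.
Proof.
rewrite in_fset_set; last first.
  apply: bigcup_finite => // i _.
  case: (X _) => f /= /asboolP ff.
  apply: (@sub_finite_set _ _ ((fun k => k - delta_mx i 0) @` [set k | f k != 0])).
    by move=> m /= h; exists (m + delta_mx i 0) => //; rewrite addrK.
  exact: finite_image.
rewrite notin_setE => h; apply/matrixP => i j; rewrite !mxE.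
by apply: contrapT => /eqP hi; apply: h; exists i.
Qed.

Lemma derD_mon (u : 'cV[C]_N) (r : 'cV[int]_N) (c : C^o) (k : 'cV[int]_N) :
  derD u r (mon c k) = mon (pairing u (expC k) * c : C^o) (k + r).
Proof.
apply: laurentP => m; rewrite coef_sum /=.
transitivity (\sum_i u i 0 * ((m - r) i 0)%:~R * (if m - r == k then c else 0) : C).
  by apply: eq_bigr => i _; rewrite -mulrA.
rewrite -mulr_suml subr_eq; case: eqP => [->|_]; last by rewrite mulr0.
by rewrite addrK pairingE; congr (_ * _); apply: eq_bigr => i _; rewrite mxE.
Qed.

Lemma derD_lin (u : 'cV[C]_N) r a (f h : A) :
  derD u r (a *: f + h) = a *: derD u r f + derD u r h.
Proof.
rewrite /derD scaler_sumr -big_split /=; apply: eq_bigr => i _.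
rewrite scalerA mulrC -scalerA -scalerDr; congr (_ *: _).
apply: laurentP => m.
rewrite -[LHS]/(_ * (a * _ + _)) -[RHS]/(a * (_ * _) + _ * _).
by rewrite mulrDr mulrCA.
Qed.

Lemma span_ind (P : set (A -> A)) :
  (forall u r, Gam (u, r) -> P (derD u r)) ->
  (P 0) -> (forall a X Y, P X -> P Y -> P (a *: X + Y)) ->
  forall X, L X -> P X.
Proof.
move=> Pg P0 PD X LX; apply: LX; first split.
- by rewrite inE.
- by move=> a Y Z; rewrite !inE; apply: PD.
- by move=> _ [[u r] /= H <-]; apply: Pg.
Qed.

Lemma L_gen u r : Gam (u, r) -> L (derD u r).
Proof. by move=> H P _; apply; exists (u, r). Qed.

Lemma L0 : L 0.
Proof. by move=> P [P0 _] _; rewrite inE in P0. Qed.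

Lemma LP a X Y : L X -> L Y -> L (a *: X + Y).
Proof.
move=> LX LY P PS GP; have [_ PD] := PS.
by have := PD a X Y; rewrite !inE; apply; [apply: LX|apply: LY].
Qed.

Lemma g0 : g 0.
Proof. by case: g_sub; rewrite inE. Qed.

Lemma gP a X Y : g X -> g Y -> g (a *: X + Y).
Proof. by move=> gX gY; case: g_sub => _ /(_ a X Y); rewrite !inE; apply. Qed.

Lemma rho_linl a X Y v : g X -> g Y -> rho (a *: X + Y) v = a *: rho X v + rho Y v.
Proof. by case: rhoP => h _ _; apply: h. Qed.

Lemma rho_linr a X v w : g X -> rho X (a *: v + w) = a *: rho X v + rho X w.
Proof. by case: rhoP => _ h _ gX; apply: h. Qed.

Lemma rho_0l v : rho 0 v = 0.
Proof.
have := rho_linl 1 v g0 g0; rewrite !scale1r addr0 => /esym/eqP.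
by rewrite -subr_eq0 addrK => /eqP.
Qed.

Lemma rho_0r X : g X -> rho X 0 = 0.
Proof.
move=> gX; have := rho_linr 1 0 0 gX; rewrite !scale1r addr0 => /esym/eqP.
by rewrite -subr_eq0 addrK => /eqP.
Qed.

Lemma symb_derD u r s : symb (derD u r) s = if s == r then u else 0.
Proof.
apply/matrixP => i j; rewrite mxE derD_mon /= mulr1 ord1.
rewrite [s + _]addrC (inj_eq (addrI _)); case: eqP => _; last by rewrite mxE.
rewrite pairingE (bigD1 i) //= big1 ?addr0 => [|l li]; last first.
  by rewrite !mxE (negPf li) mulr0.
by rewrite !mxE !eqxx mulr1.
Qed.

Lemma symb_g X r : L X -> g (expC r *m (symb X r)^T).
Proof.
move=> LX; move: X LX r; apply: span_ind => [u r H s|r|a X Y gX gY r].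
- rewrite symb_derD; case: eqP => [->|_]; first exact: Gam_g.
  by rewrite trmx0 mulmx0; apply: g0.
- have -> : symb 0 r = 0 by apply/matrixP => i j; rewrite !mxE.
  by rewrite trmx0 mulmx0; apply: g0.
- by rewrite symbP linearP /= mulmxDr -scalemxAr; apply: gP.
Qed.

Lemma L_lin X : L X -> forall a f h, X (a *: f + h) = a *: X f + X h.
Proof.
move: X; apply: span_ind => [u r _ a f h|a f h|b X Y hX hY a f h].
- exact: derD_lin.
- by rewrite -[RHS]/(a *: 0 + 0) scaler0 addr0.
- rewrite -[LHS]/(b *: X (a *: f + h) + Y (a *: f + h)).
  rewrite -[RHS]/(a *: (b *: X f + Y f) + (b *: X h + Y h)) hX hY.
  by rewrite !scalerDr !scalerA [b * a]mulrC addrACA.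
Qed.

Let gamma (r : 'cV[int]_N) := if r == 0 then alpha else beta.

Let tv u r k v : V := pairing u (expC k + gamma r) *: v + rho (expC r *m u^T) v.

Lemma tv_linr u r k a v w : g (expC r *m u^T) ->
  tv u r k (a *: v + w) = a *: tv u r k v + tv u r k w.
Proof.
move=> gu; rewrite /tv rho_linr // !scalerDr !scalerA [_ * a]mulrC.
by rewrite addrACA.
Qed.

Lemma tv_linl a u w r k v : g (expC r *m u^T) -> g (expC r *m w^T) ->
  tv (a *: u + w) r k v = a *: tv u r k v + tv w r k v.
Proof.
move=> gu gw; rewrite /tv pairingDl linearP /= mulmxDr -scalemxAr rho_linl //.
by rewrite scalerDl !scalerDr !scalerA addrACA.
Qed.

Lemma tv_0l r k v : tv 0 r k v = 0.
Proof. by rewrite /tv trmx0 mulmx0 rho_0l /pairing trmx0 mul0mx mxE scale0r addr0. Qed.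

Lemma tv_0r u r k : g (expC r *m u^T) -> tv u r k 0 = 0.
Proof. by move=> gu; rewrite /tv rho_0r // scaler0 addr0. Qed.

Definition slaction (X : A -> A) (f : F) : F :=
  \sum_(r <- symb_supp X) \sum_(k <- lsupp f) mon (tv (symb X r) r k (f k)) (k + r).

Lemma slactionE X f (S T : {fset 'cV[int]_N}) : L X ->
  (symb_supp X `<=` S)%fset -> (lsupp f `<=` T)%fset ->
  slaction X f = \sum_(r <- S) \sum_(k <- T) mon (tv (symb X r) r k (f k)) (k + r).
Proof.
move=> LX XS fT; rewrite /slaction (big_fset_incl _ XS) /=.
  apply: eq_bigr => r _; apply: (big_fset_incl _ fT) => k _ /lsuppP ->.
  by rewrite tv_0r ?mon0 //; apply: symb_g.
by move=> r _ /symb_suppP ->; rewrite big1 // => k _; rewrite tv_0l mon0.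
Qed.

Lemma slaction_linr X a (f h : F) : L X ->
  slaction X (a *: f + h) = a *: slaction X f + slaction X h.
Proof.
move=> LX; set T := (lsupp (a *: f + h)%R `|` lsupp f `|` lsupp h)%fset.
have [T1 T2 T3] : [/\ (lsupp (a *: f + h)%R `<=` T)%fset,
    (lsupp f `<=` T)%fset & (lsupp h `<=` T)%fset].
  by split; apply/fsubsetP => k; rewrite !inE => -> //; rewrite ?orbT.
rewrite (slactionE LX (fsubset_refl _) T1) (slactionE LX (fsubset_refl _) T2).
rewrite (slactionE LX (fsubset_refl _) T3) scaler_sumr -big_split /=.
apply: eq_bigr => r _; rewrite scaler_sumr -big_split /=; apply: eq_bigr => k _.
by rewrite tv_linr ?monP //; apply: symb_g.
Qed.

Lemma slaction_linl X Y a (f : F) : L X -> L Y ->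
  slaction (a *: X + Y) f = a *: slaction X f + slaction Y f.
Proof.
move=> LX LY; set T := (symb_supp (a *: X + Y)%R `|` symb_supp X `|` symb_supp Y)%fset.
have [T1 T2 T3] : [/\ (symb_supp (a *: X + Y)%R `<=` T)%fset,
    (symb_supp X `<=` T)%fset & (symb_supp Y `<=` T)%fset].
  by split; apply/fsubsetP => k; rewrite !inE => -> //; rewrite ?orbT.
rewrite (slactionE (LP a LX LY) T1 (fsubset_refl _)).
rewrite (slactionE LX T2 (fsubset_refl _)) (slactionE LY T3 (fsubset_refl _)).
rewrite scaler_sumr -big_split /=.
apply: eq_bigr => r _; rewrite scaler_sumr -big_split /=; apply: eq_bigr => k _.
by rewrite symbP tv_linl ?monP //; apply: symb_g.
Qed.

Lemma slaction_gen u r k v : L (derD u r) ->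
  slaction (derD u r) (mon v k) = mon (tv u r k v) (k + r).
Proof.
move=> LX; rewrite (@slactionE _ _ [fset r]%fset [fset k]%fset) //.
- by rewrite !big_seq_fset1 symb_derD eqxx /= eqxx.
- apply/fsubsetP => s; rewrite !inE; apply: contraTT => sr.
  rewrite in_fset_set; last first.
    apply: bigcup_finite => // i _.
    case: (derD _ _ _) => f /= /asboolP ff.
    apply: (@sub_finite_set _ _ ((fun k => k - delta_mx i 0) @` [set k | f k != 0])).
      by move=> m /= h; exists (m + delta_mx i 0) => //; rewrite addrK.
    exact: finite_image.
  rewrite notin_setE => -[i _ /=].
  have := symb_derD u r s; rewrite (negPf sr) => /matrixP /(_ i 0).
  by rewrite !mxE => ->; rewrite eqxx.
- apply/fsubsetP => m; rewrite !inE; apply: contraTT => mk.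
  rewrite in_fset_set; last by case: (mon v k) => f /= /asboolP.
  by rewrite notin_setE /= (negPf mk) eqxx.
Qed.

Lemma slaction_sum X (T : Type) (s : seq T) (G : T -> F) : L X ->
  slaction X (\sum_(i <- s) G i) = \sum_(i <- s) slaction X (G i).
Proof.
move=> LX; elim: s => [|i s IH].
  rewrite !big_nil; have := slaction_linr 1 0 0 LX; rewrite !scale1r addr0.
  by move=> /esym/eqP; rewrite -subr_eq0 addrK => /eqP.
by rewrite !big_cons -[G i]scale1r slaction_linr // !scale1r IH.
Qed.

Lemma op_br_derD u r w s :
  op_br (derD u r) (derD w s) = derD (br2 u r w s) (r + s).
Proof.
have opE h : op_br (derD u r) (derD w s) h =
    derD u r (derD w s h) - derD w s (derD u r h) by [].
apply/funext => f; rewrite [f in LHS]laurentE [f in RHS]laurentE.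
have lin X : (forall a f h, X (a *: f + h) = a *: X f + X h) ->
    X (\sum_(k <- lsupp f) mon (f k) k) = \sum_(k <- lsupp f) X (mon (f k) k : A) :> A.
  move=> XL; elim: (lsupp f : seq _) => [|i t IH].
    rewrite !big_nil; have := XL 1 0 0; rewrite !scale1r addr0.
    by move=> /esym/eqP; rewrite -subr_eq0 addrK => /eqP.
  by rewrite !big_cons -[mon (f i) i]scale1r XL !scale1r IH.
rewrite [RHS]lin; last exact: derD_lin.
rewrite lin; last first.
  move=> a x y; rewrite !opE !derD_lin.
  by rewrite scalerBr opprD addrACA.
apply: eq_bigr => k _.
rewrite opE !derD_mon.
have -> : k + s + r = k + (r + s) by rewrite [r + s]addrC addrA.
have -> : k + r + s = k + (r + s) by rewrite addrA.
rewrite -(@monB C^o); congr (mon _ _).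
rewrite -[LHS]/(pairing u (expC (k + s)) * (pairing w (expC k) * f k) -
  pairing w (expC (k + r)) * (pairing u (expC k) * f k) : C).
rewrite pairing_br !expCD !pairingDr.
ring.
Qed.

Lemma tv_br u r w s k v : Gam (u, r) -> Gam (w, s) ->
  tv (br2 u r w s) (r + s) k v =
  tv u r (k + s) (tv w s k v) - tv w s (k + r) (tv u r k v).
Proof.
move=> H1 H2; have g1 := Gam_g H1; have g2 := Gam_g H2.
have g12 := symb_g (r + s) (Gam_br H1 H2); rewrite symb_derD eqxx in g12.
pose A1 := expC r *m u^T; pose A2 := expC s *m w^T : 'M[C]_N.
have E : mx_br A1 A2 = pairing u (expC s) *: (expC r *m w^T) -
    pairing w (expC r) *: (expC s *m u^T).
  rewrite /mx_br /A1 /A2 -!mulmxA [u^T *m _]mulmxA [w^T *m _]mulmxA.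
  rewrite [u^T *m _]mx11_scalar [w^T *m _]mx11_scalar !mul_scalar_mx.
  by rewrite -!scalemxAr.
have E2 : mx_br A1 A2 = expC (r + s) *m (br2 u r w s)^T
    + (pairing w (expC r) *: A1 - pairing u (expC s) *: A2).
  rewrite E /A1 /A2 /br2; move: (pairing u _) (pairing w _) => p q.
  by apply/matrixP => i j; rewrite !(mxE, big_ord1) rmorphD /=; ring.
have gb : g (pairing w (expC r) *: A1 - pairing u (expC s) *: A2).
  by rewrite -[_ - _]addr0 -addrA -scaleNr; apply: gP => //; apply: gP => //; apply: g0.
have rhoB : rho (mx_br A1 A2) v = rho A1 (rho A2 v) - rho A2 (rho A1 v).
  by case: rhoP => _ _; apply.
have D : rho (pairing w (expC r) *: A1 - pairing u (expC s) *: A2) v =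
   pairing w (expC r) *: rho A1 v - pairing u (expC s) *: rho A2 v.
  have gn : g (- (pairing u (expC s) *: A2)).
    by rewrite -[X in g X]addr0 -scaleNr; apply: gP g2 g0.
  rewrite (rho_linl _ _ g1 gn) -[- (_ *: A2)]addr0 -scaleNr.
  by rewrite (rho_linl _ _ g2 g0) rho_0l addr0 scaleNr.
have hB : rho (expC (r + s) *m (br2 u r w s)^T) v = rho A1 (rho A2 v) -
    rho A2 (rho A1 v) - (pairing w (expC r) *: rho A1 v - pairing u (expC s) *: rho A2 v).
  by have := rho_linl 1 v g12 gb; rewrite !scale1r -E2 rhoB D => ->; rewrite addrK.
rewrite /tv hB -/A1 -/A2 pairing_br.
rewrite (rho_linr _ _ _ g1) (rho_linr _ _ _ g2).
have H : pairing u (expC s) * pairing w (expC k + gamma (r + s)) -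
    pairing w (expC r) * pairing u (expC k + gamma (r + s)) =
    pairing u (expC s) * pairing w (expC k + gamma s) -
    pairing w (expC r) * pairing u (expC k + gamma r).
  have [->|r0] := eqVneq r 0.
    by rewrite add0r expC0 !/(pairing w 0) mulmx0 mxE !mul0r.
  have [->|s0] := eqVneq s 0.
    by rewrite addr0 expC0 !/(pairing u 0) mulmx0 mxE !mul0r.
  rewrite /gamma (negPf r0) (negPf s0); case: eqP => // rs.
  case: Gam_ab => [->//|Gp].
  have -> : pairing u (expC s) = 0.
    have := Gp _ _ H1; rewrite (canRL (addrK _) rs) sub0r => h.
    apply/eqP; rewrite -oppr_eq0 -h; apply/eqP.
    rewrite !pairingE -sumrN; apply: eq_bigr => i _.
    by rewrite !mxE rmorphN mulrN.
  have -> : pairing w (expC r) = 0.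
    have := Gp _ _ H2; rewrite (canRL (addKr _) rs) addr0 => h.
    apply/eqP; rewrite -oppr_eq0 -h; apply/eqP.
    rewrite !pairingE -sumrN; apply: eq_bigr => i _.
    by rewrite !mxE rmorphN mulrN.
  by rewrite !mul0r.
rewrite H !expCD.
have -> : pairing u (expC k + expC s + gamma r) =
    pairing u (expC k + gamma r) + pairing u (expC s).
  by rewrite -pairingDr addrAC.
have -> : pairing w (expC k + expC r + gamma s) =
    pairing w (expC k + gamma s) + pairing w (expC r).
  by rewrite -pairingDr addrAC.
exact: lmod_br_identity.
Qed.

Lemma slaction_br X Y f : L X -> L Y ->
  L (op_br X Y) /\
  slaction (op_br X Y) f = slaction X (slaction Y f) - slaction Y (slaction X f).
Proof.
have brl a (Z Z' T : A -> A) : L T ->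
    op_br (a *: Z + Z') T = a *: op_br Z T + op_br Z' T.
  move=> LT; apply/funext => h.
  rewrite -[LHS]/((a *: Z (T h) + Z' (T h)) - T (a *: Z h + Z' h)).
  rewrite -[RHS]/(a *: (Z (T h) - T (Z h)) + (Z' (T h) - T (Z' h))).
  by rewrite L_lin // opprD scalerBr addrACA.
have brN (Z T : A -> A) : op_br Z T = - op_br T Z.
  apply/funext => h.
  rewrite -[LHS]/(Z (T h) - T (Z h)) -[RHS]/(- (T (Z h) - Z (T h))).
  by rewrite opprB.
have LN Z : L Z -> L (- Z) by move=> LZ; rewrite -[- Z]addr0 -scaleN1r; apply: LP L0.
have sN Z h : L Z -> slaction (- Z) h = - slaction Z h.
  move=> LZ; have := slaction_linl (-1) h LZ L0.
  rewrite addr0 !scaleN1r => ->.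
  have := slaction_linl 1 h L0 L0; rewrite !scale1r addr0 => /esym/eqP.
  by rewrite -subr_eq0 addrK => /eqP ->; rewrite addr0.
have s0 h : slaction 0 h = 0.
  by have := sN 0 h L0; have := slaction_linl 1 h L0 L0; rewrite !scale1r addr0;
    move=> /esym/eqP; rewrite -subr_eq0 addrK => /eqP.
pose law Z T := L (op_br Z T) /\ forall h,
  slaction (op_br Z T) h = slaction Z (slaction T h) - slaction T (slaction Z h).
have lawN Z T : law Z T -> law T Z.
  case=> h1 h2; rewrite /law brN; split; first exact: LN.
  by move=> h; rewrite sN // h2 opprB.
have lawP a Z Z' T : L T -> L Z -> L Z' -> law Z T -> law Z' T -> law (a *: Z + Z') T.
  move=> LT LZ LZ' [l1 h1] [l2 h2]; rewrite /law brl //; split; first exact: LP.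
  move=> h; rewrite slaction_linl // h1 h2 !slaction_linl // slaction_linr //.
  by rewrite opprD scalerBr addrACA.
have law0 T : L T -> law 0 T.
  move=> LT; have E : op_br 0 T = 0.
    apply/funext => h; rewrite -[LHS]/(0 - T 0).
    have := L_lin LT 1 0 0; rewrite !scale1r addr0 => /esym/eqP.
    by rewrite -subr_eq0 addrK => /eqP ->; rewrite subr0.
  rewrite /law E; split=> [|h]; first exact: L0.
  rewrite !s0; have := slaction_linr 1 0 0 LT; rewrite !scale1r addr0.
  by move=> /esym/eqP; rewrite -subr_eq0 addrK => /eqP ->; rewrite subr0.
suff main : forall Z, L Z -> forall T, L T -> law Z T.
  by move=> LX LY; case: (main _ LX _ LY).
move=> Z LZ; suff : L Z /\ forall T, L T -> law Z T by case.
move: Z LZ; apply: span_ind => [u r H1||a Z Z' [LZ hZ] [LZ' hZ']].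
- split; first exact: L_gen.
  move=> T LT; suff : L T /\ law (derD u r) T by case.
  move: T LT; apply: span_ind => [w s H2||a T T' [LT hT] [LT' hT']].
  + split; first exact: L_gen.
    have l1 := L_gen H1; have l2 := L_gen H2.
    rewrite /law op_br_derD; have l12 := Gam_br H1 H2; split=> // h.
    rewrite [h]laurentE !slaction_sum // -sumrB; apply: eq_bigr => k _.
    rewrite !slaction_gen // tv_br // monB.
    by rewrite addrA [k + s + r]addrAC.
  + by split; [exact: L0|exact: lawN (law0 _ (L_gen H1))].
  + split; first exact: LP.
    have lT := lawN _ _ hT; have lT' := lawN _ _ hT'.
    exact: (lawN _ _ (lawP _ _ _ _ (L_gen H1) LT LT' lT lT')).
- by split=> [|T LT]; [exact: L0|exact: law0].
- split; first exact: LP.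
  by move=> T LT; apply: lawP => //; [exact: hZ|exact: hZ'].
Qed.

Lemma slaction_module : is_lie_module (@op_br C N) L slaction.
Proof.
split.
- by move=> a X Y f LX LY; apply: slaction_linl.
- by move=> X LX a f h; apply: slaction_linr.
- by move=> X Y f LX LY; have [] := slaction_br f LX LY.
Qed.

Lemma slaction_mon u r v k : Gam (u, r) ->
  slaction (derD u r) (mon v k) =
  mon (pairing u (expC k + (if r == 0 then alpha else beta)) *: v) (k + r)
  + mon (rho (expC r *m u^T) v) (k + r).
Proof. by move=> H; rewrite slaction_gen ?monD //; apply: L_gen. Qed.

End Existence.

Lemma pairing_overlineE (C : fieldType) (n : nat) (v w : 'cV[C]_(n + n)) :
  pairing (overline v) w =
  \sum_i (v (rshift n i) 0 * w (lshift n i) 0 - v (lshift n i) 0 * w (rshift n i) 0).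
Proof.
rewrite pairingE big_split_ord /= -big_split /=; apply: eq_bigr => i _.
by rewrite /overline col_mxEu col_mxEd !mxE mulNr.
Qed.

Lemma pairing_overlineC (C : fieldType) (n : nat) (v w : 'cV[C]_(n + n)) :
  pairing (overline v) w = - pairing (overline w) v.
Proof.
rewrite !pairing_overlineE -sumrN; apply: eq_bigr => i _.
by rewrite opprB mulrC [X in _ - X]mulrC.
Qed.

Lemma pairing_overline0 (C : fieldType) (n : nat) (v : 'cV[C]_(n + n)) :
  pairing (overline v) v = 0.
Proof.
by rewrite pairing_overlineE big1 // => i _; rewrite mulrC subrr.
Qed.

Lemma derhE (C : fieldType) (n : nat) (r : 'cV[int]_(n + n)) :
  @derh C n r = derD (overline (expC r)) r.
Proof.
apply/funext => f; rewrite /derh /derD big_split_ord /= -big_split /=.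
apply: eq_bigr => i _; congr (_ *: _ + _).
  by rewrite /overline col_mxEu !mxE.
by rewrite /overline col_mxEd !mxE scaleNr.
Qed.


Lemma shen_larssonW_exists (C : fieldType) (N : nat) (V : lmodType C)
    (rho : 'M[C]_N -> V -> V) (beta : 'cV[C]_N) :
  is_lie_module (@mx_br C N) gl rho ->
  exists Phi, is_shen_larssonW rho beta Phi.
Proof.
move=> rhoP; exists (slaction rho beta beta).
have gl_sub : GRing.submod_closed (mem (@gl C N)).
  by split=> [|a x y _ _]; rewrite inE.
have Gg u r : [set: 'cV[C]_N * 'cV[int]_N] (u, r) -> gl (expC r *m u^T) by [].
split=> [|u r v k].
  apply: (slaction_module gl_sub rhoP Gg (or_introl erefl)) => u r w s _ _.
  exact: L_gen.
rewrite (slaction_mon _ _ gl_sub rhoP Gg) //.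
by case: eqP.
Qed.

Lemma shen_larssonS_exists (C : fieldType) (N : nat) (V : lmodType C)
    (rho : 'M[C]_N -> V -> V) (alpha beta : 'cV[C]_N) :
  is_lie_module (@mx_br C N) sl rho ->
  exists Phi, is_shen_larssonS rho alpha beta Phi.
Proof.
move=> rhoP; exists (slaction rho alpha beta).
have sl_sub : GRing.submod_closed (mem (@sl C N)).
  split=> [|a x y]; rewrite !inE /sl /= ?mxtrace0 // => hx hy.
  by rewrite linearP /= hx hy mulr0 addr0.
pose Gam := [set x : 'cV[C]_N * 'cV[int]_N | pairing x.1 (expC x.2) = 0].
have Gg u r : Gam (u, r) -> sl (expC r *m u^T).
  by rewrite /Gam /sl /= mxtrace_mulC trace_mx11.
split=> [|u r v k r0 ur|i v k].
- apply: (slaction_module sl_sub rhoP Gg); first by right=> u r.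
  move=> u r w s ur ws; apply: L_gen; rewrite /Gam /= in ur ws *.
  by rewrite pairing_br !expCD !pairingDr ur ws add0r addr0 mulrC subrr.
- by rewrite (slaction_mon _ _ sl_sub rhoP Gg) // (negPf r0).
- rewrite tdiff_derD (slaction_mon _ _ sl_sub rhoP Gg) ?eqxx ?addr0.
    by rewrite expC0 mul0mx (rho_0l sl_sub rhoP) mon0 addr0 pairing_delta !mxE.
  by rewrite /Gam /= expC0 /pairing mulmx0 mxE.
Qed.

Lemma shen_larssonH_exists (C : fieldType) (n : nat) (V : lmodType C)
    (rho : 'M[C]_(n + n) -> V -> V) (alpha beta : 'cV[C]_(n + n)) :
  is_lie_module (@mx_br C (n + n)) sp rho ->
  exists Phi, is_shen_larssonH rho alpha beta Phi.
Proof.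
move=> rhoP; exists (slaction rho alpha beta).
have sp_sub : GRing.submod_closed (mem (@sp C n)).
  split=> [|a x y]; rewrite !inE /sp /=.
    by rewrite trmx0 mul0mx mulmx0 addr0.
  move=> hx hy; rewrite linearP /= mulmxDl mulmxDr -scalemxAl -scalemxAr addrACA.
  by rewrite -scalerDr hx hy scaler0 addr0.
pose Gam := [set x : 'cV[C]_(n + n) * 'cV[int]_(n + n) |
  (x.2 != 0 /\ x.1 = overline (expC x.2)) \/
  (x.2 = 0 /\ exists i, x.1 = delta_mx i 0)].
have ovE (w : 'cV[C]_(n + n)) : overline w = Jmx C n *m w.
  rewrite -[w in RHS]vsubmxK /Jmx mul_block_col !mul0mx mul1mx add0r addr0.
  by rewrite mulNmx mul1mx.
have JT : (Jmx C n)^T = - Jmx C n.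
  by rewrite /Jmx tr_block_mx !linear0 linearN /= trmx1 opp_block_mx !oppr0 opprK.
have LE : lieH = subspace_span [set derD x.1 x.2 | x in Gam].
  congr subspace_span; apply/seteqP; split.
    move=> _ [[r /= r0 <-]|[i _ <-]].
      exists (overline (expC r), r); first by left.
      by rewrite derhE.
    exists (delta_mx i 0, 0); last by rewrite tdiff_derD.
    by right; split=> //; exists i.
  move=> _ [[u r] /= + <-] => -[/= [r0 ->]|/= [-> [i ->]]].
    by left; exists r => //; rewrite derhE.
  by right; exists i => //; rewrite tdiff_derD.
have Gg u r : Gam (u, r) -> sp (expC r *m u^T).
  case=> [[_ /= ->]|[/= -> _]]; rewrite /sp /=; last first.
    by rewrite expC0 mul0mx trmx0 mul0mx mulmx0 addr0.
  rewrite ovE trmx_mul trmxK trmx_mul JT.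
  by rewrite mulmxN mulmxN -!mulmxA mulmxN mulmxA subrr.
have Gp u r : Gam (u, r) -> pairing u (expC r) = 0.
  case=> [[_ /= ->]|[/= -> _]]; last by rewrite expC0 /pairing mulmx0 mxE.
  exact: pairing_overline0.
split=> [|r v k r0|i v k].
- rewrite LE; apply: (slaction_module sp_sub rhoP Gg); first by right.
  move=> u r w s G1 G2.
  have scaleL c z m : Gam (z, m) ->
      subspace_span [set derD x.1 x.2 | x in Gam] (derD (c *: z) m).
    move=> Gz; have -> : derD (c *: z) m = c *: derD z m + 0.
      rewrite addr0; apply/funext => f.
      rewrite -[RHS]/(c *: derD z m f) /derD scaler_sumr.
      by apply: eq_bigr => i _; rewrite mxE scalerA.
    by apply: LP; [exact: L_gen|exact: L0].
  case: (G1) => /= [[r0 Eu]|[r0 _]]; last first.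
    rewrite r0 add0r expC0 [pairing w 0]/pairing mulmx0 mxE scale0r subr0.
    exact: scaleL.
  case: (G2) => /= [[s0 Ew]|[s0 _]]; last first.
    rewrite s0 addr0 expC0 [pairing u 0]/pairing mulmx0 mxE scale0r sub0r -scaleNr.
    exact: scaleL.
  have -> : pairing u (expC s) *: w - pairing w (expC r) *: u =
      pairing u (expC s) *: overline (expC (r + s)).
    have -> : pairing w (expC r) = - pairing u (expC s).
      by rewrite Eu Ew pairing_overlineC.
    by rewrite scaleNr opprK -scalerDr expCD !ovE mulmxDr addrC Eu Ew !ovE.
  have [rs|rs] := eqVneq (r + s) 0.
    rewrite rs expC0 ovE mulmx0 scaler0 -(scale0r u).
    have -> : derD (0 *: u) 0 = derD (0 *: u) r; last exact: scaleL.
    apply/funext => f; rewrite /derD.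
    by rewrite !big1 // => i _; rewrite mxE mul0r scale0r.
  by apply: scaleL; left.
- by rewrite derhE (slaction_mon _ _ sp_sub rhoP Gg) ?(negPf r0) //; left.
- have Gi : Gam (delta_mx i 0, 0) by right; split=> //; exists i.
  rewrite tdiff_derD (slaction_mon _ _ sp_sub rhoP Gg) // eqxx addr0.
  by rewrite expC0 mul0mx (rho_0l sp_sub rhoP) mon0 addr0 pairing_delta !mxE.
Qed.

End Existence.

(* Main.v *)
(* For a matrix [a] put [X_s = rho (s (a s)^T)], where [a] ranges over all
   matrices for W, over the alternating ones for S, and is [J] for H; these
   operators span the image of [g]. With [lambda = l + beta], [kappa = k + beta],
   the element [D(a (l - k), l - k)] sends [v (x) t^k] to [D v (x) t^l], where
     D = (a (lambda - kappa) | kappa) + X_(lambda - kappa)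
   is quadratic in [lambda] and in [kappa]. Let [P] be a nonzero submodule, graded
   by components [P_k] in [V], and let [Y] be the space of the [y] such that
   [X_lambda y] is in [P_l] for all [a] and [l]. A polynomial map with values in a
   subspace on the lattice Z^N + beta has all its coefficients in that subspace.
   For [y] in [Y], the part of degree 2 in [kappa] of [D_b (X^a_kappa y)], which
   lies in [P_l], is [X^b_lambda X^a_kappa y]; so [Y] is a [g]-submodule. If [Y = 0]
   and [v] is in [P_k], the parts of degree 0 and 1 in [mu] of
   [D_b(lambda, mu) D_a(mu, kappa) v] show that the parts of degree 0 and 1 in
   [lambda] of [D_a(lambda, kappa) v] vanish, whence [X_lambda v] is in [P_l] and
   [v = 0]. Hence [Y = V]: every nonzero submodule contains all [X_lambda V (x) t^l],
   so any two nonzero submodules meet and every nonzero submodule is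
   indecomposable; the trivial summand is always zero. *)
From HB Require Import structures.
Require Import Defs.
From mathcomp Require Import all_boot all_order all_algebra.
From mathcomp Require Import finmap all_classical reals.
From mathcomp Require Import ssrAC ring.

Set Implicit Arguments.
Unset Strict Implicit.
Unset Printing Implicit Defensive.

Import GRing.Theory.

Local Open Scope classical_set_scope.
Local Open Scope ring_scope.

(** * Subspaces, and coefficients of polynomials recovered from their values *)

Lemma linear_at0 {C : fieldType} {V W : lmodType C} (f : V -> W) :
  linear f -> f 0 = 0.
Proof.
move=> /(_ 1 0 0); rewrite !scale1r addr0 => /esym/eqP.
by rewrite -subr_eq0 addrK => /eqP.
Qed.

Section Subspaces.
Context {C : fieldType} {V : lmodType C}.

Lemma submod_closedP (U : set V) :
  U 0 -> (forall a x y, U x -> U y -> U (a *: x + y)) ->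
  GRing.submod_closed (mem U).
Proof. by move=> U0 UP; split=> [|a x y]; rewrite !inE //; apply: UP. Qed.

Variable U : set V.
Hypothesis US : GRing.submod_closed (mem U).

Lemma submod0 : U 0.
Proof. by case: US; rewrite inE. Qed.

Lemma submodP a x y : U x -> U y -> U (a *: x + y).
Proof. by move=> Ux Uy; case: US => _ /(_ a x y); rewrite !inE; apply. Qed.

Lemma submodZ a x : U x -> U (a *: x).
Proof. by move=> Ux; rewrite -[a *: x]addr0; apply: submodP => //; apply: submod0. Qed.

Lemma submodD x y : U x -> U y -> U (x + y).
Proof. by move=> Ux; rewrite -[x]scale1r; apply: submodP; rewrite ?scale1r. Qed.

Lemma submodB x y : U x -> U y -> U (x - y).
Proof. by move=> Ux Uy; rewrite addrC -scaleN1r; apply: submodP. Qed.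

Lemma submod_sum (I : Type) (r : seq I) (P : pred I) (F : I -> V) :
  (forall i, P i -> U (F i)) -> U (\sum_(i <- r | P i) F i).
Proof. by move=> UF; elim/big_ind: _ => //; [apply: submod0|apply: submodD]. Qed.

Hypothesis char0 : GRing.has_char0 C.

Lemma intr_eq0_char0 (z : int) : ((z%:~R : C) == 0) = (z == 0).
Proof.
have h n := (GRing.pcharf0P C).1 char0 n.
by case: z => n; rewrite ?NegzE ?rmorphN ?oppr_eq0 ?h.
Qed.

Lemma intr_inj_char0 : injective (fun z : int => z%:~R : C).
Proof.
by move=> x y /eqP; rewrite -subr_eq0 -rmorphB intr_eq0_char0 subr_eq0 => /eqP.
Qed.

(** The nodes [b + m] are distinct in characteristic zero, so the Vandermonde matrix on the first
    [n] of them is invertible and each coefficient is a linear combination of [n] values. *)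
Lemma poly_coef_sub (n : nat) (c : nat -> V) (b : C) :
  (forall m : nat, U (\sum_(j < n) (b + m%:R) ^+ j *: c j)) ->
  forall j, (j < n)%N -> U (c j).
Proof.
move=> Uc j0 lj; pose j := Ordinal lj.
pose A : 'M[C]_n := Vandermonde n (\row_(m < n) (b + m%:R)).
have Au : A \in unitmx.
  rewrite unitmxE det_Vandermonde unitfE; apply/prodf_neq0 => i _.
  apply/prodf_neq0 => l il; rewrite !mxE opprD addrACA subrr add0r subr_eq0.
  apply: contraTneq il => h; have /intr_inj_char0 [->] : (l%:Z%:~R : C) = i%:Z%:~R := h.
  by rewrite ltnn.
suff -> : c j0 = \sum_(m < n) invmx A m j *: \sum_(i < n) (b + m%:R) ^+ i *: c i.
  by apply: submod_sum => m _; apply: submodZ.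
under eq_bigr do rewrite scaler_sumr.
rewrite exchange_big /= (bigD1 j) //= [X in _ + X]big1 ?addr0 => [|i ij].
  under eq_bigr do rewrite scalerA mulrC.
  rewrite -scaler_suml -[LHS]scale1r; congr (_ *: _).
  have /matrixP/(_ j j) := mulmxV Au; rewrite !mxE eqxx => h.
  by rewrite -[LHS]/(true%:R) -[LHS]h; apply: eq_bigr => m _; rewrite !mxE.
under eq_bigr do rewrite scalerA mulrC.
rewrite -scaler_suml; have /matrixP/(_ i j) := mulmxV Au.
rewrite !mxE (negPf ij) => h; rewrite -[RHS](scale0r (c i)) -[X in _ = X *: _]h.
by congr (_ *: _); apply: eq_bigr => m _; rewrite !mxE.
Qed.

End Subspaces.

(** * Polynomial maps and density of a translated lattice *)

Section PolynomialMaps.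
Context {C : fieldType} {N : nat} {V : lmodType C}.
Implicit Types f : 'cV[C]_N -> V.

(** Polynomiality is asked only along lines, with degree and coefficients depending on the line.
    This suffices for a density argument that moves one coordinate at a time. *)
Definition line_polynomial f := forall x d, exists n (c : nat -> V),
  forall t : C, f (x + t *: d) = \sum_(j < n) t ^+ j *: c j.

Definition quadratic_family (T : 'cV[C]_N -> V -> V) := forall x d,
  exists T0 T1 T2 : {linear V -> V},
  forall t v, T (x + t *: d) v = T0 v + t *: T1 v + t ^+ 2 *: T2 v.

Lemma line_polynomial_cst (v : V) : line_polynomial (fun=> v).
Proof.
move=> x d; exists 1%N, (fun=> v) => t.
by rewrite big_ord1 expr0 scale1r.
Qed.

Lemma line_polynomial_quadratic (T : 'cV[C]_N -> V -> V) f :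
  quadratic_family T -> line_polynomial f -> line_polynomial (fun x => T x (f x)).
Proof.
move=> Tq fp x d; have [n [c fE]] := fp x d; have [T0 [T1 [T2 TE]]] := Tq x d.
(* Padding [c] by zeros lets the products with [1], [t] and [t ^+ 2] be summed over the same [n.+2]
   degrees. *)
pose c' (j : nat) := if (j < n)%N then c j else 0.
have c'0 j : (n <= j)%N -> c' j = 0 by move=> nj; rewrite /c' ltnNge nj.
exists n.+2, (fun j => T0 (c' j) + (if j is i.+1 then T1 (c' i) else 0)
  + (if j is i.+2 then T2 (c' i) else 0)) => t.
have shift (S : {linear V -> V}) m : t ^+ m *: S (f (x + t *: d)) =
    \sum_(j < n) t ^+ (j + m) *: S (c' j).
  rewrite fE linear_sum scaler_sumr; apply: eq_bigr => j _.
  by rewrite linearZ scalerA -exprD addnC /c' ltn_ord.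
rewrite TE -[T0 _]scale1r -(expr0 t) -[t in t *: T1 _]expr1 !shift.
under [RHS]eq_bigr do rewrite !scalerDr.
rewrite !big_split /=; congr (_ + _ + _).
- rewrite !big_ord_recr /= !c'0 // linear0 !scaler0 !addr0.
  by apply: eq_bigr => j _; rewrite addn0.
- rewrite big_ord_recl /= scaler0 add0r big_ord_recr /= /bump /= c'0 //.
  rewrite linear0 scaler0 addr0.
  by apply: eq_bigr => j _; rewrite addn1.
- rewrite !big_ord_recl /= !scaler0 !add0r.
  by apply: eq_bigr => j _; rewrite addn2.
Qed.

(** Coordinates are released from the lattice one at a time: along a coordinate line [f] is a
    polynomial in one variable, and its values in [U] at the lattice nodes put all its coefficients
    in [U]. *)
Lemma lattice_dense (U : set V) (beta : 'cV[C]_N) f :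
  GRing.has_char0 C -> GRing.submod_closed (mem U) -> line_polynomial f ->
  (forall k, U (f (expC k + beta))) -> forall x, U (f x).
Proof.
move=> char0 US fp Uk x.
(* [s] lists the released coordinates; the others agree with those of a lattice point. *)
suff main (s : seq 'I_N) (y : 'cV[C]_N) (k : 'cV[int]_N) :
    (forall i, i \notin s -> y i 0 = (expC k + beta) i 0) -> U (f y).
  by apply: (main (enum 'I_N) x 0) => i; rewrite mem_enum.
elim: s y k => [|i s IH] y k yk.
  by rewrite (_ : y = expC k + beta) //; apply/colP => i; apply: yk.
have [n [c fE]] := fp y (delta_mx i 0).
(* The offset is such that moving [y] by [beta i 0 - y i 0 + m] along coordinate [i] brings this
   coordinate to [beta i 0 + m], back on the lattice. *)
have Uc := @poly_coef_sub _ _ U US char0 n c (beta i 0 - y i 0).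
rewrite -[y]addr0 -(scale0r (delta_mx i 0)) fE.
apply: (submod_sum US) => j _; apply: (submodZ US); apply: (Uc) => // m; rewrite -fE.
apply: (IH _ (\col_l if l == i then m%:Z else k l 0)) => l ls.
have [->|li] := eqVneq l i.
  by rewrite !mxE !eqxx mulr1; ring.
rewrite !mxE (negPf li) mulr0 addr0 yk ?mxE //.
by rewrite inE negb_or li.
Qed.

Lemma lattice_coef (U : set V) (beta : 'cV[C]_N) f q (s : seq V) :
  GRing.has_char0 C -> GRing.submod_closed (mem U) -> line_polynomial f ->
  (forall k, U (f (expC k + beta))) ->
  (forall t, f (t *: q) = \sum_(j < size s) t ^+ j *: s`_j) ->
  forall j, U s`_j.
Proof.
move=> char0 US fp Uk fE j; have [js|sj] := ltnP j (size s); last first.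
  by rewrite nth_default //; apply: submod0.
apply: (@poly_coef_sub _ _ U US char0 (size s) (nth 0 s) 0) => // m.
by rewrite -fE; apply: lattice_dense fp Uk _.
Qed.

End PolynomialMaps.

(** * The pairing and the rank-one matrices [s (a s)^T] *)

Section Pairing.
Context {C : fieldType} {N : nat}.
Implicit Types u v w : 'cV[C]_N.

Lemma pairingZl c u v : pairing (c *: u) v = c * pairing u v.
Proof. by rewrite /pairing linearZ -scalemxAl mxE. Qed.

Lemma pairingZr c u v : pairing u (c *: v) = c * pairing u v.
Proof. by rewrite /pairing -scalemxAr mxE. Qed.

Lemma pairingDl u w v : pairing (u + w) v = pairing u v + pairing w v.
Proof. by rewrite /pairing linearD mulmxDl mxE. Qed.

Lemma pairingNl u v : pairing (- u) v = - pairing u v.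
Proof. by rewrite -scaleN1r pairingZl mulN1r. Qed.

Lemma pairing0r u : pairing u 0 = 0.
Proof. by rewrite /pairing mulmx0 mxE. Qed.

(** Taking [u = a s] turns the matrix [s u^T] of the Shen-Larsson formula into a quadratic function
    of [s]. *)
Definition rank1 (a : 'M[C]_N) (s : 'cV[C]_N) : 'M[C]_N := s *m (a *m s)^T.

Definition rank1_polar (a : 'M[C]_N) (s d : 'cV[C]_N) : 'M[C]_N := s *m (a *m d)^T + d *m (a *m s)^T.

Lemma rank1_line a x d (t : C) :
  rank1 a (x + t *: d) = rank1 a x + t *: rank1_polar a x d + t ^+ 2 *: rank1 a d.
Proof.
rewrite /rank1 /rank1_polar mulmxDr -scalemxAr.
move: (a *m x) (a *m d) => y z; apply/matrixP => i j.
by rewrite !(mxE, big_ord1); ring.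
Qed.

Lemma rank10 a : rank1 a 0 = 0.
Proof. by rewrite /rank1 mul0mx. Qed.

Lemma rank1_polarE a s d : rank1_polar a s d = rank1 a (s + d) - rank1 a s - rank1 a d.
Proof.
have := rank1_line a s d 1; rewrite expr1n !scale1r => ->.
by rewrite addrAC addrK addrAC subrr add0r.
Qed.

End Pairing.

(** * Graded families of subspaces of [V] stable under the operators [D] *)

Section GradedFamilies.
Context {C : fieldType} {N : nat} {V : lmodType C}.
Variables (rho : 'M[C]_N -> V -> V) (g : set 'M[C]_N) (A : set 'M[C]_N).
Variable beta : 'cV[C]_N.
Variable P : 'cV[int]_N -> set V.

Hypothesis char0 : GRing.has_char0 C.
Hypothesis rhoP : is_lie_module (@mx_br C N) g rho.
Hypothesis rho_irr : irreducible_module g rho.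
Hypothesis gS : GRing.submod_closed (mem g).
Hypothesis rank1_g : forall a s, A a -> g (rank1 a s).
Hypothesis g_span :
  g `<=` subspace_span [set rank1 x.1 x.2 | x in [set x | A x.1]].

Let op (p : C) (Z : 'M[C]_N) (v : V) := p *: v + rho Z v.

Let op_linear p Z : g Z -> linear (op p Z).
Proof.
move=> gZ c v w; rewrite /op (Existence.rho_linr rhoP) // !scalerDr !scalerA.
by rewrite [p * c]mulrC addrACA.
Qed.

Let opE p0 p1 p2 Z0 Z1 Z2 (t : C) v : g Z0 -> g Z1 -> g Z2 ->
  op (p0 + t * p1 + t ^+ 2 * p2) (Z0 + t *: Z1 + t ^+ 2 *: Z2) v =
  op p0 Z0 v + t *: op p1 Z1 v + t ^+ 2 *: op p2 Z2 v.
Proof.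
move=> g0 g1 g2; rewrite /op.
have -> : Z0 + t *: Z1 + t ^+ 2 *: Z2 = t ^+ 2 *: Z2 + (t *: Z1 + Z0).
  by rewrite addrC [Z0 + _]addrC.
rewrite !(Existence.rho_linl rhoP) //; last exact: submodP.
rewrite !scalerDl !scalerDr !scalerA.
rewrite [X in _ + X](addrC _ (_ + _)) [X in _ + (X + _)]addrC.
by rewrite addrACA; congr (_ + _); rewrite addrACA.
Qed.

Let X a s := op 0 (rank1 a s).

(* The element [D(a r, r)] with [r = l - k], acting between the components of
   degrees [k] and [l] of a Shen-Larsson module. *)
Let D a (l k : 'cV[C]_N) := op (pairing (a *m (l - k)) k) (rank1 a (l - k)).

Let polar_g a s d : A a -> g (rank1_polar a s d).
Proof. by move=> Aa; rewrite rank1_polarE; do !apply: submodB => //; apply: rank1_g. Qed.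

Let X_line a x d t v : A a ->
  X a (x + t *: d) v = X a x v + t *: op 0 (rank1_polar a x d) v + t ^+ 2 *: X a d v.
Proof.
move=> Aa; rewrite /X rank1_line -opE //; try exact: rank1_g; last exact: polar_g.
by rewrite !mulr0 !addr0.
Qed.

(** The scalar part of [D] is only linear in [l], so the leading coefficient is [X a d], without
    scalar term. *)
Let D_line_l a k x d t v : A a ->
  D a (x + t *: d) k v =
  D a x k v + t *: op (pairing (a *m d) k) (rank1_polar a (x - k) d) v
  + t ^+ 2 *: X a d v.
Proof.
move=> Aa; rewrite /D /X addrAC rank1_line -opE //; try exact: rank1_g; last exact: polar_g.
by rewrite mulmxDr -scalemxAr pairingDl pairingZl mulr0 addr0.
Qed.

Let D_line_r a l x d t v : A a ->
  D a l (x + t *: d) v =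
  D a l x v
  + t *: op (pairing (a *m (l - x)) d - pairing (a *m d) x)
           (- rank1_polar a (l - x) d) v
  + t ^+ 2 *: op (- pairing (a *m d) d) (rank1 a d) v.
Proof.
move=> Aa; have gN : g (- rank1_polar a (l - x) d).
  by rewrite -sub0r; apply: submodB => //; [apply: submod0|apply: polar_g].
rewrite -opE //; try exact: rank1_g.
rewrite /D opprD addrA -scaleNr rank1_line sqrrN scalerN -(scaleNr t (rank1_polar _ _ _)).
congr (op _ _ v); rewrite mulmxDr -scalemxAr pairingDl pairingZl.
by rewrite !(Existence.pairingDr, pairingZr); ring.
Qed.

Let linear_map p Z : g Z -> {S : {linear V -> V} | S =1 op p Z}.
Proof.
move=> gZ; pose S : {linear V -> V} :=
  HB.pack (op p Z) (GRing.isLinear.Build _ _ _ _ (op p Z) (op_linear p gZ)).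
by exists S.
Qed.

Let quadratic_op (T : 'cV[C]_N -> V -> V) :
  (forall x d, exists p0 p1 p2 Z0 Z1 Z2, [/\ g Z0, g Z1, g Z2 &
    forall t v, T (x + t *: d) v =
      op p0 Z0 v + t *: op p1 Z1 v + t ^+ 2 *: op p2 Z2 v]) ->
  quadratic_family T.
Proof.
move=> TE x d; have [p0 [p1 [p2 [Z0 [Z1 [Z2 [g0 g1 g2 {}TE]]]]]]] := TE x d.
have [S0 E0] := linear_map p0 g0; have [S1 E1] := linear_map p1 g1.
have [S2 E2] := linear_map p2 g2.
by exists S0, S1, S2 => t v; rewrite E0 E1 E2.
Qed.

Let X_quadratic a : A a -> quadratic_family (X a).
Proof.
move=> Aa; apply: quadratic_op => x d; do 6!eexists; split; last first.
- by move=> t v; apply: X_line.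
- exact: rank1_g.
- exact: polar_g.
- exact: rank1_g.
Qed.

Lemma rank1_line_polynomial a v : A a -> line_polynomial (fun s => rho (rank1 a s) v).
Proof.
move=> Aa; rewrite (_ : (fun s => _) = fun s => X a s v); last first.
  by apply/funext => s; rewrite /X /op scale0r add0r.
exact: line_polynomial_quadratic (X_quadratic Aa) (line_polynomial_cst v).
Qed.

Let D_quadratic_l a k : A a -> quadratic_family (fun l => D a l k).
Proof.
move=> Aa; apply: quadratic_op => x d; do 6!eexists; split; last first.
- by move=> t v; apply: D_line_l.
- exact: rank1_g.
- exact: polar_g.
- exact: rank1_g.
Qed.

Let D_quadratic_r a l : A a -> quadratic_family (D a l).
Proof.
move=> Aa; apply: quadratic_op => x d; do 6!eexists; split; last first.
- by move=> t v; apply: D_line_r.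
- exact: rank1_g.
- by rewrite -sub0r; apply: submodB => //; [apply: submod0|apply: polar_g].
- exact: rank1_g.
Qed.

Hypothesis PS : forall k, GRing.submod_closed (mem (P k)).
Hypothesis PD : forall a k l v, A a -> P k v ->
  P l (pairing (a *m (expC (l - k))) (expC k + beta) *: v +
       rho (rank1 a (expC (l - k))) v).

Let P_D a k l v : A a -> P k v -> P l (D a (expC l + beta) (expC k + beta) v).
Proof.
move=> Aa Pv; rewrite /D.
have -> : expC l + beta - (expC k + beta) = expC (l - k) :> 'cV[C]_N.
  by apply/colP => i; rewrite !mxE rmorphB; ring.
exact: PD.
Qed.

Let Y : set V := [set y | forall a l, A a -> P l (X a (expC l + beta) y)].

Let D0 a l v : D a l 0 v = X a l v.
Proof. by rewrite /D /X pairing0r subr0. Qed.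

Let XP a s : A a -> linear (X a s).
Proof. by move=> Aa; apply: op_linear; apply: rank1_g. Qed.

Let Y_submod : GRing.submod_closed (mem Y).
Proof.
apply: submod_closedP => [|c x y Yx Yy] a l Aa.
  by rewrite (linear_at0 (XP _ Aa)); apply: submod0.
by rewrite XP //; apply: submodP; [exact: PS|exact: Yx|exact: Yy].
Qed.

(** Put [lam = expC l + beta]. The map sending [k] to [D b lam k (T k)] takes values in [P l] on the
    lattice, so its coefficients along the line through [q] lie in [P l]; those of degree 0, 1 and 2
    are listed. Here [D b lam (t *: q)] is [B0 + t B1 + t ^+ 2 B2], with constant term [X b lam] by
    [D0]. *)
Let D_coef (T : 'cV[C]_N -> V) q p0 p1 p2 b l : A b ->
  line_polynomial T -> (forall k, P k (T (expC k + beta))) ->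
  (forall t, T (t *: q) = p0 + t *: p1 + t ^+ 2 *: p2) ->
  exists B1 B2 : {linear V -> V}, let B0 := X b (expC l + beta) in
  [/\ P l (B0 p0), P l (B0 p1 + B1 p0) & P l (B0 p2 + B1 p1 + B2 p0)].
Proof.
move=> Ab Tp PT TE; set lam := expC l + beta.
have fp : line_polynomial (fun k => D b lam k (T k)).
  exact: line_polynomial_quadratic (D_quadratic_r _ Ab) Tp.
have gN : g (- rank1_polar b (lam - 0) q).
  by rewrite -sub0r; apply: submodB => //; [apply: submod0|apply: polar_g].
have [B0 E0] : {S : {linear V -> V} | S =1 X b lam} := linear_map 0 (rank1_g lam Ab).
have [B1 E1] := linear_map (pairing (b *m (lam - 0)) q - pairing (b *m q) 0) gN.
have [B2 E2] := linear_map (- pairing (b *m q) q) (rank1_g q Ab).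
(* The five coefficients in [t] of a product of two quadratics. *)
pose s := [:: B0 p0; B0 p1 + B1 p0; B0 p2 + B1 p1 + B2 p0; B1 p2 + B2 p1; B2 p2].
have sE t : D b lam (t *: q) (T (t *: q)) = \sum_(j < size s) t ^+ j *: s`_j.
  rewrite -[X in D _ _ X]add0r D_line_r // D0 -E0 -E1 -E2 TE.
  rewrite !big_ord_recl big_ord0 /= !linearD !linearZ /= !scalerA.
  rewrite /bump /= expr0 scale1r expr1 addr0 -exprSr -exprS -exprD -expr2.
  by rewrite (AC (3*3*3) (1*((2*4)*(((3*5)*7)*((6*8)*9))))).
have Ps := lattice_coef char0 (PS l) fp (fun k => P_D l Ab (PT k)) sE.
by exists B1, B2 => /=; rewrite -!E0; split; [exact: Ps 0|exact: Ps 1|exact: Ps 2].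
Qed.

(** [X a (t *: q) y] is homogeneous of degree two in [t], so [p0] and [p1] vanish and the last
    conclusion of [D_coef] reduces to its first term. *)
Let Y_stable a q y : A a -> Y y -> Y (X a q y).
Proof.
move=> Aa Yy b l Ab.
have TE t : X a (t *: q) y = 0 + t *: 0 + t ^+ 2 *: X a q y.
  have := X_line 0 q t y Aa; rewrite add0r => ->.
  have -> : rank1_polar a 0 q = 0 by rewrite rank1_polarE add0r rank10 subr0 subrr.
  by rewrite /X rank10 /op !scale0r !add0r (Existence.rho_0l gS rhoP) scaler0 !add0r.
have Tp : line_polynomial (fun k => X a k y).
  exact: line_polynomial_quadratic (X_quadratic Aa) (line_polynomial_cst y).
have [|B1 [B2 [_ _]]] := D_coef l Ab Tp _ TE; first by move=> k; apply: Yy.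
by rewrite !linear0 !addr0.
Qed.

Let Y_eq0 v k : (forall y, Y y -> y = 0) -> P k v -> v = 0.
Proof.
move=> Y0 Pv; set kap := expC k + beta.
apply: (Y0) => a l Aa.
have TE q t : D a (t *: q) kap v =
    op (pairing (a *m (0 - kap)) kap) (rank1 a (0 - kap)) v +
    t *: op (pairing (a *m q) kap) (rank1_polar a (0 - kap) q) v + t ^+ 2 *: X a q v.
  by rewrite -[t *: q]add0r D_line_l.
have Tp : line_polynomial (fun m => D a m kap v).
  exact: line_polynomial_quadratic (D_quadratic_l kap Aa) (line_polynomial_cst v).
have PT m : P m (D a (expC m + beta) kap v) by apply: P_D.
(* The constant term is the same for every [q], so [q = 0] will do. *)
have p0 : op (pairing (a *m (0 - kap)) kap) (rank1 a (0 - kap)) v = 0.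
  apply: Y0 => b m Ab.
  by have [B1 [B2 []]] := D_coef m Ab Tp PT (TE 0).
have p1 q : op (pairing (a *m q) kap) (rank1_polar a (0 - kap) q) v = 0.
  apply: Y0 => b m Ab.
  by have [B1 [B2 [_]]] := D_coef m Ab Tp PT (TE q); rewrite p0 linear0 addr0.
(* For [q = expC l + beta] and [t = 1], all that is left of [D a q kap v] is [X a q v], which
   therefore lies in [P l]. *)
by have := PT l; rewrite -[expC l + beta]scale1r TE p0 p1 expr1n !scale1r !add0r.
Qed.

Lemma rank1_sub_graded k v a l w :
  v != 0 -> P k v -> A a -> P l (rho (rank1 a (expC l + beta)) w).
Proof.
move=> v0 Pv Aa.
have [|Y0|YT] := rho_irr.2 Y.
- split; first exact: Y_submod.
  (* Stability under the generators [rank1 b q] extends to their span; [S] records membership in [g]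
     because [rho] is linear only there. *)
  move=> Z y gZ Yy; pose S := [set Z | g Z /\ Y (rho Z y)].
  suff : S Z by case.
  apply: (g_span gZ); last first.
    move=> _ [[b q] /= Ab <-]; split; first exact: rank1_g.
    have := Y_stable q Ab Yy.
    by rewrite /X /op scale0r add0r.
  apply: submod_closedP => [|c Z1 Z2 [g1 Y1] [g2 Y2]]; split.
  + exact: submod0.
  + by rewrite (Existence.rho_0l gS rhoP); apply: submod0 Y_submod.
  + exact: submodP.
  + by rewrite (Existence.rho_linl rhoP) //; apply: submodP Y_submod _ _ _ _ _.
- case/eqP: v0; apply: Y_eq0 Pv => y; rewrite Y0.
  by [].
- have : Y w by rewrite YT.
  by move/(_ a l Aa); rewrite /X /op scale0r add0r.
Qed.

End GradedFamilies.

(** * Absence of invariants in a non-trivial irreducible module *)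

Lemma invariants_eq0 {C : fieldType} {E : lmodType C} {br : E -> E -> E}
    {g : set E} {V : lmodType C} {rho : E -> V -> V} (v : V) :
  nontrivial_irreducible br g rho -> (forall X, g X -> rho X v = 0) -> v = 0.
Proof.
case=> rhoP [_ rho_irr] rho_nontriv gv0.
have rho0 X : g X -> rho X 0 = 0.
  by move=> gX; apply: linear_at0; have [_ + _] := rhoP; apply.
have KS : is_submodule g rho [set w | forall X, g X -> rho X w = 0].
  split; last by move=> X w gX Kw Z gZ; rewrite Kw // rho0.
  apply: submod_closedP => // a x y Kx Ky X gX.
  by have [_ /(_ X gX) -> _] := rhoP; rewrite Kx // Ky // scaler0 addr0.
have [K0|KT] := rho_irr _ KS.
  by have : [set 0] v by rewrite -K0.
have {KS} triv X w : g X -> rho X w = 0.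
  have : [set w | forall X, g X -> rho X w = 0] w by rewrite KT.
  by move=> /[apply].
(* Here [g] acts by zero, so the line through a nonzero [v] is a submodule and hence all of [V]; the
   coordinate [f] along [v] would identify [V] with the trivial module. *)
apply: contrapT => /eqP v0; apply: rho_nontriv.
have /choice[f fE] w : exists c : C, w = c *: v.
  have [|L0|LT] := rho_irr [set w | exists c, w = c *: v].
  - split; last by move=> X w' gX _; exists 0; rewrite triv // scale0r.
    apply: submod_closedP => [|a _ _ [b ->] [c ->]]; first by exists 0; rewrite scale0r.
    by exists (a * b + c); rewrite scalerDl scalerA.
  - have : [set 0] v by rewrite -L0; exists 1; rewrite scale1r.
    by move=> /= v00; rewrite v00 eqxx in v0.
  - by have : [set w | exists c, w = c *: v] w by rewrite LT.
have fK c : f (c *: v) = c.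
  apply/eqP; rewrite -subr_eq0; have /eqP := fE (c *: v).
  by rewrite eq_sym -subr_eq0 -scalerBl scaler_eq0 (negPf v0) orbF.
have f_lin : linear (f : V -> C^o).
  by move=> a x y; rewrite {1}(fE x) {1}(fE y) scalerA -scalerDl fK.
pose F : {linear V -> C^o} := HB.pack (f : V -> C^o)
  (GRing.isLinear.Build _ _ _ _ (f : V -> C^o) f_lin).
exists F; split.
  by exists (fun c => c *: v) => [w|c] /=; rewrite ?fK -?fE.
by move=> X w gX; rewrite triv // linear0.
Qed.

(** * Submodules of Shen-Larsson modules, for the three Lie algebras at once *)

Section ShenLarssonSubmodules.
Context {C : fieldType} {N : nat} {V : lmodType C}.
Variables (rho : 'M[C]_N -> V -> V) (g A : set 'M[C]_N) (alpha beta : 'cV[C]_N).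
Variable L : set (laurent_alg C N -> laurent_alg C N).
Variable Phi :
  (laurent_alg C N -> laurent_alg C N) -> laurent N V -> laurent N V.

Hypothesis char0 : GRing.has_char0 C.
Hypothesis rhoN : nontrivial_irreducible (@mx_br C N) g rho.
Hypothesis gS : GRing.submod_closed (mem g).
Hypothesis rank1_g : forall a s, A a -> g (rank1 a s).
Hypothesis g_span :
  g `<=` subspace_span [set rank1 x.1 x.2 | x in [set x | A x.1]].
Hypothesis PhiP : is_lie_module (@op_br C N) L Phi.
Hypothesis L_tdiff : forall i, L (@tdiff C N i).
Hypothesis Phi_tdiff : forall i v k,
  Phi (@tdiff C N i) (mon v k) = mon (((k i 0)%:~R + alpha i 0) *: v) k.
Hypothesis L_derD : forall a r, A a -> r != 0 -> L (derD (a *m expC r) r).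
Hypothesis Phi_derD : forall a r v k, A a -> r != 0 ->
  Phi (derD (a *m expC r) r) (mon v k) =
  mon (pairing (a *m expC r) (expC k + beta) *: v) (k + r)
  + mon (rho (rank1 a (expC r)) v) (k + r).

Lemma Phi_tdiff_coef i (f : laurent N V) m :
  Phi (@tdiff C N i) f m = ((m i 0)%:~R + alpha i 0) *: f m.
Proof.
have [_ Phi_lin _] := PhiP.
pose S : {linear laurent N V -> laurent N V} := HB.pack (Phi (@tdiff C N i))
  (GRing.isLinear.Build _ _ _ _ (Phi (@tdiff C N i)) (Phi_lin _ (L_tdiff i))).
rewrite [f]Existence.laurentE -[Phi _]/(S : _ -> _) linear_sum.
rewrite !Existence.coef_sum scaler_sumr; apply: eq_bigr => k _ /=.
by rewrite Phi_tdiff /=; case: eqP => [->|_]; rewrite ?scaler0.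
Qed.

(** The [tdiff i] act on degree [m] by the scalars [m i 0 + alpha i 0], which jointly separate
    degrees in characteristic zero. The degrees of [f] other than [k] are removed one by one. *)
Lemma submodule_graded (M : set (laurent N V)) f k :
  is_submodule L Phi M -> M f -> M (mon (f k) k).
Proof.
case=> MS Mstab.
suff main (s : seq 'cV[int]_N) : forall f, M f ->
    (forall m, m \notin k :: s -> f m = 0) -> M (mon (f k) k).
  move=> Mf; apply: (main (Existence.lsupp f) f Mf) => m.
  by rewrite inE negb_or => /andP[_]; apply: Existence.lsuppP.
elim: s => [|l s IH] {}f Mf fs.
  rewrite (_ : mon (f k) k = f) //; apply: Existence.laurentP => m /=.
  by case: eqP => [->//|/eqP mk]; rewrite fs // inE.
have [lk|/eqP lk] := eqVneq l k.
  by apply: IH => // m; rewrite !inE => mks; apply: fs; rewrite !inE lk orbA orbb.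
have [i li] : exists i, l i 0 != k i 0.
  by apply: contra_notP lk => h; apply/colP => i; apply: contra_notP h => /eqP; exists i.
have c0 : (k i 0)%:~R - (l i 0)%:~R != 0 :> C.
  by rewrite -rmorphB intr_eq0_char0 // subr_eq0 eq_sym.
(* Applying [d_i - (l_i + alpha_i)] kills the coefficient at [l]; the factor in front keeps the one
   at [k] unchanged, and [alpha] cancels. *)
pose h := ((k i 0)%:~R - (l i 0)%:~R)^-1 *:
  (- ((l i 0)%:~R + alpha i 0) *: f + Phi (@tdiff C N i) f).
have hE m : h m = (((m i 0)%:~R - (l i 0)%:~R) / ((k i 0)%:~R - (l i 0)%:~R)) *: f m.
  rewrite -[LHS]/(_ *: (_ *: f m + Phi (@tdiff C N i) f m)) Phi_tdiff_coef.
  by rewrite -scalerDl scalerA; congr (_ *: _); rewrite mulrC; congr (_ / _); ring.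
have -> : f k = h k by rewrite hE divff // scale1r.
apply: IH => [|m mks].
  by apply: submodZ => //; apply: submodP => //; apply: Mstab.
rewrite hE; have [->|ml] := eqVneq m l; first by rewrite subrr mul0r scale0r.
by rewrite fs ?scaler0 //; move: mks; rewrite !inE !negb_or ml => /andP[-> ->].
Qed.

Lemma submodule_rank1 (M : set (laurent N V)) a l w :
  is_submodule L Phi M -> M <> [set 0] -> A a ->
  M (mon (rho (rank1 a (expC l + beta)) w) l).
Proof.
move=> MP M0 Aa; have [MS Mstab] := MP; have [rhoP rho_irr _] := rhoN.
have [f Mf f0] : exists2 f, M f & f != 0.
  apply: contra_notP M0 => h; apply/seteqP; split=> [f Mf /=|_ ->].
    by apply: contra_notP h => /eqP f0; exists f.
  exact: submod0.
have [k fk] : exists k, f k != 0.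
  apply: contra_notP (elimN eqP f0) => h; apply: Existence.laurentP => k.
  by apply: contra_notP h => /eqP; exists k.
pose P k := [set v : V | M (mon v k)].
apply: (@rank1_sub_graded _ _ _ rho g A beta P) fk _ Aa => //.
- move=> m; apply: submod_closedP => [|c x y Mx My].
    by rewrite /P /= Existence.mon0; apply: submod0.
  by rewrite /P /= Existence.monP; apply: submodP.
- move=> b m p v Ab Mv; rewrite /P /= Existence.monD.
  (* [Phi_derD] covers only nonzero degrees; for [p = m] both terms vanish. *)
  have [pm|pm] := eqVneq (p - m) 0.
    rewrite pm Existence.expC0 rank10 mulmx0 (Existence.rho_0l gS rhoP).
    rewrite /pairing trmx0 mul0mx mxE scale0r !Existence.mon0 addr0.
    exact: submod0.
  have := Mstab _ _ (L_derD Ab pm) Mv; rewrite Phi_derD //.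
  by rewrite [m + _]addrC subrK.
- exact: submodule_graded.
Qed.

(* Two nonzero submodules always meet: both contain the vectors of
   [submodule_rank1]. *)
Lemma submodule_indecomposable (M : set (laurent N V)) :
  is_submodule L Phi M -> M <> [set 0] -> indecomposable L Phi M.
Proof.
move=> MP M0; split=> // P Q PP QP [_ PQ0]; have [rhoP rho_irr _] := rhoN.
apply: contrapT => /not_orP[P0 Q0].
have kill a l w : A a -> rho (rank1 a (expC l + beta)) w = 0.
  move=> Aa; have : (P `&` Q) (mon (rho (rank1 a (expC l + beta)) w) l).
    by split; apply: submodule_rank1.
  rewrite PQ0 => /(congr1 (fun f : laurent N V => f l)).
  by rewrite /= eqxx.
have S0 : GRing.submod_closed (mem [set 0 : V]).
  by apply: submod_closedP => // c _ _ -> ->; rewrite scaler0 addr0.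
(* Density with target the zero subspace carries the vanishing from the points [expC l + beta] to
   every [s]; then [g] annihilates [V], which [invariants_eq0] excludes. *)
have killC a s w : A a -> rho (rank1 a s) w = 0.
  move=> Aa; have fp := rank1_line_polynomial rhoP gS rank1_g w Aa.
  by apply: (lattice_dense char0 S0 fp) => l; apply: kill.
case: rho_irr => VT _; apply: VT; apply/seteqP; split=> // w _ /=.
apply: (invariants_eq0 rhoN) => X gX; pose S := [set X | g X /\ rho X w = 0].
suff : S X by case.
apply: (g_span gX) => [|_ [[a s] /= Aa <-]]; last by split; [exact: rank1_g|exact: killC].
apply: submod_closedP => [|c X1 X2 [g1 K1] [g2 K2]]; split.
- exact: submod0.
- exact: Existence.rho_0l gS rhoP _.
- exact: submodP.
- by rewrite (Existence.rho_linl rhoP) // K1 K2 scaler0 addr0.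
Qed.

Lemma shen_larsson_indecomposable :
  indecomposable L Phi [set: laurent N V] /\
  (forall M, is_submodule L Phi M -> M <> [set 0] -> M <> [set: laurent N V] ->
     indecomposable_up_to_trivial L Phi M).
Proof.
have [rhoP [VT _] _] := rhoN; have [_ Phi_lin _] := PhiP.
have Phi0 X : L X -> Phi X 0 = 0.
  by move=> LX; apply/linear_at0/Phi_lin.
split=> [|M MP M0 _].
  apply: submodule_indecomposable.
    by split=> //; apply: submod_closedP.
  move=> F0; apply: VT; apply/seteqP; split=> // v _ /=.
  have : [set 0 : laurent N V] (mon v 0) by rewrite -F0.
  by move=> /(congr1 (fun f : laurent N V => f 0)) /=; rewrite eqxx.
(* [M] is itself indecomposable, so the zero submodule serves as trivial summand. *)
exists M, [set 0]; split.
- exact: submodule_indecomposable.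
- split; last by move=> X _ LX ->; rewrite Phi0.
  by apply: submod_closedP => // c _ _ -> ->; rewrite scaler0 addr0.
- by move=> u r _ _ LD ->; rewrite Phi0.
- split; apply/seteqP; split=> f /=.
  + by move=> Mf; exists f => //; exists 0 => //; rewrite addr0.
  + by case=> x Mx [_ -> <-]; rewrite addr0.
  + by case.
  + by move=> ->; split=> //; apply: submod0; case: MP.
Qed.

End ShenLarssonSubmodules.

(** * Spanning [gl], [sl] and [sp] by rank-one matrices *)

Section Span.
Context {C : fieldType} {E : lmodType C} (S : set E).

Lemma subspace_span_gen X : S X -> subspace_span S X.
Proof. by move=> SX P _; apply. Qed.

Lemma subspace_span_submod : GRing.submod_closed (mem (subspace_span S)).
Proof.
apply: submod_closedP => [P PS _|a x y Sx Sy P PS SP]; first exact: submod0 PS.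
by apply: (submodP PS); [apply: Sx|apply: Sy].
Qed.

End Span.

Lemma tr_Jmx (C : fieldType) n : (Jmx C n)^T = - Jmx C n.
Proof.
by rewrite /Jmx tr_block_mx !linear0 linearN /= trmx1 opp_block_mx !oppr0 opprK.
Qed.

Section RankOneSpans.
Context {C : fieldType}.

Let span_rank1 N (A : set 'M[C]_N) : set 'M[C]_N :=
  subspace_span [set rank1 x.1 x.2 | x in [set x | A x.1]].

Let span_rank1S N (A : set 'M[C]_N) : GRing.submod_closed (mem (span_rank1 A)).
Proof. exact: subspace_span_submod. Qed.

Let rank1_span N (A : set 'M[C]_N) a s : A a -> span_rank1 A (rank1 a s).
Proof. by move=> Aa; apply: subspace_span_gen; exists (a, s). Qed.

Lemma gl_span N : gl `<=` span_rank1 [set: 'M[C]_N].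
Proof.
have TS := @span_rank1S N setT.
move=> Z _; rewrite (matrix_sum_delta Z).
apply: (submod_sum TS) => i _; apply: (submod_sum TS) => j _; apply: (submodZ TS).
have -> : delta_mx i j = rank1 (delta_mx j i) (delta_mx i 0) :> 'M[C]_N.
  by rewrite /rank1 mul_delta_mx trmx_delta mul_delta_mx.
exact: rank1_span.
Qed.

(** For these [a] one has [(a r | r) = 0], so [D(a r, r)] lies in [S_N] for every [r]. *)
Definition alternating N : set 'M[C]_N := [set a | forall s, pairing (a *m s) s = 0].

Lemma sl_span N : sl `<=` span_rank1 (@alternating N).
Proof.
have TS m := @span_rank1S m (@alternating m).
move=> Z Ztr; case: N Z Ztr => [|N] Z Ztr.
  by rewrite [Z]flatmx0; apply: (submod0 (TS _)).
pose a (i j : 'I_N.+1) : 'M[C]_N.+1 := delta_mx j i - delta_mx i j.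
have alt_a i j : alternating (a i j).
  have dE (k l : 'I_N.+1) (s : 'cV[C]_N.+1) : delta_mx k l *m s = s l 0 *: delta_mx k 0.
    rewrite -(mul_delta_mx (0 : 'I_1)) -mulmxA -rowE [row l s]mx11_scalar.
    by rewrite mul_mx_scalar mxE.
  move=> s; rewrite mulmxBl !dE pairingDl pairingNl !pairingZl !Existence.pairing_delta.
  by rewrite mulrC subrr.
have off (i j : 'I_N.+1) : i != j -> span_rank1 (@alternating _) (delta_mx i j).
  move=> ij; have -> : delta_mx i j = rank1 (a i j) (delta_mx i 0) :> 'M[C]_N.+1.
    rewrite /rank1 mulmxBl mul_delta_mx mul_delta_mx_cond eq_sym (negPf ij) mulr0n.
    by rewrite subr0 trmx_delta mul_delta_mx.
  exact: rank1_span.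
have diag (i : 'I_N.+1) : span_rank1 (@alternating _) (delta_mx i i - delta_mx 0 0).
  have [->|i0] := eqVneq i 0; first by rewrite subrr; apply: (submod0 (TS _)).
  (* For [s = e_0 + e_i] one has [a s = e_i - e_0], and [s (a s)^T] is the wanted difference plus
     [E_0i - E_i0]. *)
  have -> : delta_mx i i - delta_mx 0 0 = rank1 (a 0 i) (delta_mx 0 0 + delta_mx i 0)
      - delta_mx 0 i + delta_mx i 0 :> 'M[C]_N.+1.
    rewrite /rank1 mulmxDr !mulmxBl !mul_delta_mx_cond !eqxx [0 == i]eq_sym.
    rewrite (negPf i0) !mulr1n !mulr0n subr0 sub0r.
    rewrite linearB /= !trmx_delta mulmxDl !mulmxBr !mul_delta_mx.
    by apply/matrixP => k l; rewrite !mxE; ring.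
  apply: (submodD (TS _)); last exact: off.
  apply: (submodB (TS _)); last by apply: off; rewrite eq_sym.
  exact: rank1_span.
(* The subtracted terms add up to [\tr Z] times [delta_mx 0 0], which is zero. *)
have -> : Z = \sum_i \sum_j Z i j *:
    (delta_mx i j - (i == j)%:R *: delta_mx 0 0).
  rewrite {1}(matrix_sum_delta Z); apply/eqP; rewrite -subr_eq0 -sumrB.
  under eq_bigr => i _.
    rewrite -sumrB (bigD1 i) //= big1 ?addr0 => [|j ji].
    over.
    by rewrite eq_sym (negPf ji) scale0r subr0 subrr.
  under eq_bigr do rewrite eqxx scale1r -scalerBr opprB addrC subrK.
  by rewrite -scaler_suml -[X in X *: _]/(\tr Z) Ztr scale0r.
apply: (submod_sum (TS _)) => i _; apply: (submod_sum (TS _)) => j _; apply: (submodZ (TS _)).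
by have [<-|ij] := eqVneq i j; [rewrite scale1r|rewrite scale0r subr0; apply: off].
Qed.

(** [rank1 J s] is [- s s^T J], and every [Z] in [sp] is [B J] with [B] symmetric. Symmetric
    matrices are spanned by the squares [s s^T] through polarization, which divides by two. *)
Lemma sp_span n : GRing.has_char0 C -> sp `<=` span_rank1 [set Jmx C n].
Proof.
have TS := @span_rank1S _ [set Jmx C n].
move=> char0 Z Zsp; pose J := Jmx C n.
have JT : J^T = - J by apply: tr_Jmx.
have JJ : J *m J = - 1%:M.
  rewrite /J /Jmx mulmx_block !mul0mx !mulmx0 !mul1mx !mulmx1 !addr0 !add0r.
  by rewrite scalar_mx_block opp_block_mx !oppr0.
pose B := - Z *m J.
have BT : B^T = B.
  have /eqP := Zsp; rewrite addr_eq0 => /eqP ZJ.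
  have : J *m (Z^T *m J) *m J = - (J *m (J *m Z) *m J) by rewrite ZJ mulmxN mulNmx.
  rewrite -!mulmxA JJ !mulmxA JJ mulmxN mulmx1 !mulNmx mul1mx opprK => JZ.
  by rewrite /B trmx_mul JT linearN /= mulNmx mulmxN opprK mulNmx -JZ opprK.
have two : (2%:R : C) != 0 by rewrite (GRing.pcharf0P C).1.
have -> : Z = - 2%:R^-1 *: \sum_i \sum_j B i j *:
    rank1_polar J (delta_mx i 0) (delta_mx j 0).
  have ZE : Z = B *m J by rewrite /B -mulmxA JJ mulmxN mulmx1 opprK.
  have pE i j : rank1_polar J (delta_mx i 0) (delta_mx j 0) =
      - ((delta_mx i j + delta_mx j i) *m J).
    rewrite /rank1_polar !trmx_mul JT !mulmxN !mulmxA !trmx_delta !mul_delta_mx.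
    by rewrite mulmxDl opprD.
  under eq_bigr => i _ do under eq_bigr do rewrite pE scalerN scalemxAl scalerDr.
  under eq_bigr do rewrite sumrN -mulmx_suml big_split /=.
  rewrite sumrN -mulmx_suml big_split /= -matrix_sum_delta exchange_big /=.
  under eq_bigr => i _ do under eq_bigr => j _ do rewrite -{1}BT [B^T _ _]mxE.
  rewrite -matrix_sum_delta scalerN scaleNr opprK mulmxDl -ZE -mulr2n -scaler_nat.
  by rewrite scalerA mulVf // scale1r.
apply: (submodZ TS); apply: (submod_sum TS) => i _; apply: (submod_sum TS) => j _.
apply: (submodZ TS); rewrite rank1_polarE.
by do !apply: (submodB TS); apply: rank1_span.
Qed.

End RankOneSpans.

Lemma overlineE (C : fieldType) n (w : 'cV[C]_(n + n)) : overline w = Jmx C n *m w.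
Proof.
rewrite -[w in RHS]vsubmxK /Jmx mul_block_col !mul0mx mul1mx add0r addr0.
by rewrite mulNmx mul1mx.
Qed.

(** * The cases of [W], [S] and [H] *)

Lemma shen_larssonW_indecomposable (C : fieldType) N (beta : 'cV[C]_N)
    (V : lmodType C) (rho : 'M[C]_N -> V -> V) Phi :
  GRing.has_char0 C -> nontrivial_irreducible (@mx_br C N) gl rho ->
  is_shen_larssonW rho beta Phi ->
  indecomposable lieW Phi [set: laurent N V] /\
  (forall M : set (laurent N V),
     is_submodule lieW Phi M -> M <> [set 0] -> M <> [set: laurent N V] ->
     indecomposable_up_to_trivial lieW Phi M).
Proof.
move=> char0 rhoN [PhiP PhiE].
have L_D (u : 'cV[C]_N) r : lieW (derD u r).
  by apply: subspace_span_gen; exists (u, r).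
have glS : GRing.submod_closed (mem (@gl C N)) by apply: submod_closedP.
(* In [W] the [d_i] are the [D(e_i, 0)], so they act through [beta], which is taken for [alpha]. *)
apply: (@shen_larsson_indecomposable C N V rho gl setT beta beta) => //.
- exact: gl_span.
- by move=> i; rewrite Existence.tdiff_derD.
- move=> i v k; rewrite Existence.tdiff_derD PhiE Existence.expC0 mul0mx.
  have [rhoP _ _] := rhoN.
  rewrite (Existence.rho_0l glS rhoP) Existence.mon0 !addr0 Existence.pairing_delta.
  by rewrite !mxE.
Qed.

Lemma shen_larssonS_indecomposable (C : fieldType) N (alpha beta : 'cV[C]_N)
    (V : lmodType C) (rho : 'M[C]_N -> V -> V) Phi :
  GRing.has_char0 C -> nontrivial_irreducible (@mx_br C N) sl rho ->
  is_shen_larssonS rho alpha beta Phi ->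
  indecomposable lieS Phi [set: laurent N V] /\
  (forall M : set (laurent N V),
     is_submodule lieS Phi M -> M <> [set 0] -> M <> [set: laurent N V] ->
     indecomposable_up_to_trivial lieS Phi M).
Proof.
move=> char0 rhoN [PhiP PhiE Phi_tdiff].
have L_D (u : 'cV[C]_N) r : pairing u (expC r) = 0 -> lieS (derD u r).
  by move=> ur; apply: subspace_span_gen; exists (u, r).
have slS : GRing.submod_closed (mem (@sl C N)).
  apply: submod_closedP => [|c X Y]; rewrite /sl /= ?mxtrace0 // => X0 Y0.
  by rewrite linearP /= X0 Y0 mulr0 addr0.
apply: (@shen_larsson_indecomposable C N V rho sl (@alternating C N) alpha beta) => //.
- by move=> a s alt_a; rewrite /sl /= /rank1 mxtrace_mulC trace_mx11; apply: alt_a.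
- exact: sl_span.
- by move=> i; rewrite Existence.tdiff_derD; apply: L_D; rewrite Existence.expC0 pairing0r.
- by move=> a r alt_a _; apply: L_D.
- by move=> a r v k alt_a r0; apply: PhiE.
Qed.

Lemma shen_larssonH_indecomposable (C : fieldType) n (alpha beta : 'cV[C]_(n + n))
    (V : lmodType C) (rho : 'M[C]_(n + n) -> V -> V) Phi :
  GRing.has_char0 C -> nontrivial_irreducible (@mx_br C (n + n)) sp rho ->
  is_shen_larssonH rho alpha beta Phi ->
  indecomposable lieH Phi [set: laurent (n + n) V] /\
  (forall M : set (laurent (n + n) V),
     is_submodule lieH Phi M -> M <> [set 0] -> M <> [set: laurent (n + n) V] ->
     indecomposable_up_to_trivial lieH Phi M).
Proof.
move=> char0 rhoN [PhiP PhiE Phi_tdiff].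
have spS : GRing.submod_closed (mem (@sp C n)).
  apply: submod_closedP => [|c X Y]; rewrite /sp /=.
    by rewrite trmx0 mul0mx mulmx0 addr0.
  move=> X0 Y0; rewrite linearP /= mulmxDl mulmxDr -scalemxAl -scalemxAr addrACA.
  by rewrite -scalerDr X0 Y0 scaler0 addr0.
(* Since [J r] is [overline r], the choice [a = J] makes [D(a r, r)] equal to [h_r]. *)
apply: (@shen_larsson_indecomposable C _ V rho sp [set Jmx C n] alpha beta) => //.
- move=> _ s ->; rewrite /sp /= /rank1 trmx_mul trmxK trmx_mul.
  by rewrite tr_Jmx !mulmxN !mulmxA subrr.
- exact: sp_span.
- by move=> i; apply: subspace_span_gen; right; exists i.
- move=> _ r -> r0; rewrite -overlineE -Existence.derhE.
  by apply: subspace_span_gen; left; exists r.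
- by move=> _ r v k -> r0; rewrite /rank1 -overlineE -Existence.derhE; apply: PhiE.
Qed.

Theorem theorem1p3 (R : realType) :
  [/\ (forall (N : nat) (beta : 'cV[R[i]]_N) (V : lmodType R[i])
         (rho : 'M[R[i]]_N -> V -> V)
         (Phi : (laurent_alg R[i] N -> laurent_alg R[i] N) ->
                laurent N V -> laurent N V),
         (2 <= N)%N ->
         nontrivial_irreducible (@mx_br R[i] N) gl rho ->
         is_shen_larssonW rho beta Phi ->
         indecomposable lieW Phi [set: laurent N V] /\
         (forall M : set (laurent N V),
            is_submodule lieW Phi M -> M <> [set 0] -> M <> [set: laurent N V] ->
            indecomposable_up_to_trivial lieW Phi M)),
      (forall (N : nat) (alpha beta : 'cV[R[i]]_N) (V : lmodType R[i])
         (rho : 'M[R[i]]_N -> V -> V)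
         (Phi : (laurent_alg R[i] N -> laurent_alg R[i] N) ->
                laurent N V -> laurent N V),
         (2 <= N)%N ->
         nontrivial_irreducible (@mx_br R[i] N) sl rho ->
         is_shen_larssonS rho alpha beta Phi ->
         indecomposable lieS Phi [set: laurent N V] /\
         (forall M : set (laurent N V),
            is_submodule lieS Phi M -> M <> [set 0] -> M <> [set: laurent N V] ->
            indecomposable_up_to_trivial lieS Phi M)) &
      (forall (n : nat) (alpha beta : 'cV[R[i]]_(n + n)) (V : lmodType R[i])
         (rho : 'M[R[i]]_(n + n) -> V -> V)
         (Phi : (laurent_alg R[i] (n + n) -> laurent_alg R[i] (n + n)) ->
                laurent (n + n) V -> laurent (n + n) V),
         (1 <= n)%N ->
         nontrivial_irreducible (@mx_br R[i] (n + n)) sp rho ->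
         is_shen_larssonH rho alpha beta Phi ->
         indecomposable lieH Phi [set: laurent (n + n) V] /\
         (forall M : set (laurent (n + n) V),
            is_submodule lieH Phi M -> M <> [set 0] ->
            M <> [set: laurent (n + n) V] ->
            indecomposable_up_to_trivial lieH Phi M))].
Proof.
have char0 : GRing.has_char0 R[i].
  by apply/GRing.pcharf0P => n; rewrite Num.Theory.pnatr_eq0.
split=> [N beta V rho Phi _|N alpha beta V rho Phi _|n alpha beta V rho Phi _].
- exact: shen_larssonW_indecomposable.
- exact: shen_larssonS_indecomposable.
- exact: shen_larssonH_indecomposable.
Qed.
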